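(* For all $z$ such that $0<|\ln z|\le 2\pi$, \[ \sum_{k=1}^\infty\frac{(\ln z)^{2k+1}B_{2k}}{k(2k+1)!} = \frac{\pi^2}{3}-\frac12\ln^2 z+2\ln z\,\big(1-\ln(-\ln z)\big)-2\operatorname{Li}_2(z). \]
   Context: $B_j$ are the Bernoulli numbers (with $\zeta(2n)=\frac{(-1)^{n+1}(2\pi)^{2n}}{2(2n)!}B_{2n}$). $\operatorname{Li}_2(x)=\sum_{k\ge1}x^k/k^2$ is the dilogarithm (analytically continued). $\ln$ denotes the natural logarithm (principal branch). *)

(* Defs.v *)
From Stdlib Require Import Reals.
From Coquelicot Require Import Coquelicot.

Open Scope R_scope.

(** Principal argument of a complex number, with values in (-PI, PI]
    (and Carg 0 = 0, a junk value never used below). *)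
Definition Carg (z : Complex.C) : R :=
  let x := fst z in let y := snd z in
  if Rlt_dec 0 x then atan (y / x)
  else if Rlt_dec x 0 then
    (if Rle_dec 0 y then atan (y / x) + PI else atan (y / x) - PI)
  else if Rlt_dec 0 y then PI / 2
  else if Rlt_dec y 0 then - (PI / 2)
  else 0.

Definition Clog (z : Complex.C) : Complex.C := (ln (Cmod z), Carg z).

(** Bernoulli numbers, via the recurrence
    B_0 = 1,  sum_{j=0}^{n} C(n+1, j) B_j = 0  (n >= 1), i.e. B_1 = -1/2.
    [bern_upto n j] = B_j for j <= n. *)
Fixpoint bern_upto (n : nat) : nat -> R :=
  match n with
  | O => fun _ => 1
  | S m => fun j =>
      if Nat.leb j m then bern_upto m j
      else - (/ INR (m + 2)) *
           sum_f_R0 (fun i => Binomial.C (m + 2) i * bern_upto m i) m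
  end.

Definition Bernoulli (n : nat) : R := bern_upto n n.

Definition Li2_term (z : Complex.C) (k : nat) : Complex.C :=
  match k with
  | O => 0%C
  | S _ => Cdiv (Cpow z k) (RtoC (INR k ^ 2))
  end.

Definition Li2_series (z : Complex.C) : Complex.C :=
  (Series (fun k => Re (Li2_term z k)), Series (fun k => Im (Li2_term z k))).

(** Principal branch of the dilogarithm Li_2 on all of C:
    the power series on the closed unit disc, and for |z| > 1 the standard
    analytic continuation given by the inversion formula
    Li_2(z) = - Li_2(1/z) - pi^2/6 - (1/2) ln^2(-z). *)
Definition Li2 (z : Complex.C) : Complex.C :=
  if Rle_dec (Cmod z) 1 then Li2_series z
  else Cminus (Cminus (Copp (Li2_series (Cinv z))) (RtoC (PI ^ 2 / 6)))
              (Cmult (RtoC (1 / 2)) (Cpow (Clog (Copp z)) 2)).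

(* Main.v *)
Require Import Defs.
From Stdlib Require Import Reals Factorial Wf_nat Lra Lia.
From Coquelicot Require Import Coquelicot.

(** Write [w = Clog z], let [S w] be the series and [R w] the right-hand side with
    [Li2 (exp w)] given by its power series.

    The function [(w / 2) coth (w / 2) - 1], whose Taylor coefficients are the
    [B_n / n!] for [n >= 2], satisfies a Riccati equation.  It makes the coefficients of
    [1 - (x / 2) cot (x / 2)] nonnegative and lets the partial sums of that series be
    compared with the function itself, so the series converges up to the pole at [2 pi],
    with a bound [O(1 / (2 pi - x))]; two integrations give the absolute convergence of
    [S] on the closed disc [|w| <= 2 pi].

    On the half-disc [Re w < 0, |w| < 2 pi] one has [S'' = R''], because both are
    [2 / (exp w - 1) + 1 - 2 / w].  Moreover [S' - R'] tends to [0] as [w] tends to [0]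
    along the reals, so [S - R] is a constant, also on the closed half-disc by dominated
    convergence.  Comparing real parts at [w = i pi] and [w = i pi / 2] with
    [Re (Li2 i) = Li2 (-1) / 4] shows that it vanishes.  For [Re w > 0] both sides are odd
    in [w]: for [R] this is the inversion formula of the dilogarithm, as [Clog (- w)] and
    [Clog (- z)] pick up the same multiple of [i pi]. *)

(** * Bernoulli numbers *)

(** The obstacle is the radius of convergence. The recurrence alone gives [Rabs (bern_coef n) <= 1],
    hence a radius of at least 1, while the theorem reaches the circle of radius [2 * PI]. Neither a
    partial fraction expansion of the cotangent nor analyticity up to the nearest pole is invoked.
    Instead an identity between functions on [Rabs x < 1] becomes a quadratic recursion for the
    coefficients, and once these are known to be nonnegative, every partial sum is compared with the
    explicit cotangent function on the whole of [(0, 2 PI)]. On the circle itself the series of the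
    cotangent diverges, because of the pole. The Bernoulli series carries the extra factor
    [1 / (n (n + 1))], and a second antiderivative of [1 / (2 PI - x)] stays bounded at [2 PI]. The
    right-hand side has a logarithm at [w = 0], so no constant of integration can be found by
    substituting [0]. The second constant is determined on the imaginary axis because an odd series
    is purely imaginary there: only elementary terms and the dilogarithm on the unit circle remain
    in the real part. *)

Lemma is_derive_Rplus (f g : R -> R) (x l m : R) :
  is_derive f x l -> is_derive g x m -> is_derive (fun t => f t + g t) x (l + m).
Proof. exact (is_derive_plus (K := R_AbsRing) (V := R_NormedModule) f g x l m). Qed.

Lemma is_derive_Rminus (f g : R -> R) (x l m : R) :
  is_derive f x l -> is_derive g x m -> is_derive (fun t => f t - g t) x (l - m).
Proof. exact (is_derive_minus (K := R_AbsRing) (V := R_NormedModule) f g x l m). Qed.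

Lemma is_derive_Rmult (f g : R -> R) (x l m : R) :
  is_derive f x l -> is_derive g x m ->
  is_derive (fun t => f t * g t) x (l * g x + f x * m).
Proof.
  intros Hf Hg.
  apply (is_derive_mult (K := R_AbsRing) f g x l m Hf Hg). exact Rmult_comm.
Qed.

Lemma is_derive_Rconst (c x : R) : is_derive (fun _ : R => c) x 0.
Proof. exact (is_derive_const (K := R_AbsRing) (V := R_NormedModule) c x). Qed.

Lemma bern_upto_eq (n j : nat) : (j <= n)%nat -> bern_upto n j = Bernoulli j.
Proof.
  induction n as [|n IH]; intros Hj.
  - now replace j with 0%nat by lia.
  - destruct (Nat.eq_dec j (S n)) as [->|Hne]; [reflexivity|].
    simpl. replace (Nat.leb j n) with true by (symmetry; apply Nat.leb_le; lia).
    apply IH; lia.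
Qed.

(** The Taylor coefficients of [x / (exp x - 1)]. *)
Definition bern_coef (n : nat) : R := Bernoulli n / INR (fact n).

(** The Taylor coefficients of [(exp x - 1) / x]. *)
Definition exp1_coef (n : nat) : R := / INR (fact (S n)).

(** As a sequence in [n], the coefficients of the monomial [x ^ m]. *)
Definition delta (m n : nat) : R := if Nat.eqb n m then 1 else 0.

(** Dividing the binomial recurrence of the Bernoulli numbers by [(n + 1)!] turns it into a Cauchy
    product: [x / (exp x - 1)] times [(exp x - 1) / x] is [1]. *)
Lemma bern_coef_rec (n : nat) :
  sum_f_R0 (fun j => bern_coef j * exp1_coef (n - j)) n = delta 0 n.
Proof.
  destruct n as [|m].
  - unfold bern_coef, exp1_coef, delta; simpl. unfold Bernoulli; simpl. field.
  - rewrite tech5, Nat.sub_diag.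
    assert (Hs : sum_f_R0 (fun j => bern_coef j * exp1_coef (S m - j)) m =
      / INR (fact (m + 2)) *
      sum_f_R0 (fun i => Binomial.C (m + 2) i * bern_upto m i) m).
    { rewrite scal_sum. apply sum_eq; intros i Hi.
      rewrite bern_upto_eq by assumption.
      unfold bern_coef, exp1_coef, Binomial.C.
      replace (S (S m - i)) with (m + 2 - i)%nat by lia.
      field. repeat split; apply INR_fact_neq_0. }
    rewrite Hs. set (X := sum_f_R0 _ m).
    unfold bern_coef at 1. unfold Bernoulli.
    replace (bern_upto (S m) (S m)) with (- (/ INR (m + 2)) * X).
    2: { cbn [bern_upto]. rewrite (proj2 (Nat.leb_gt (S m) m)) by lia. reflexivity. }
    unfold exp1_coef, delta; simpl (Nat.eqb (S m) 0). cbv iota.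
    replace (m + 2)%nat with (S (S m)) by lia.
    rewrite (fact_simpl (S m)), mult_INR.
    simpl (fact 1). simpl (INR 1). field.
    split; [apply not_0_INR; lia|apply INR_fact_neq_0].
Qed.

Lemma exp1_coef_bound (n : nat) : 0 < exp1_coef n <= (/ 2) ^ n.
Proof.
  unfold exp1_coef. split.
  - apply Rinv_0_lt_compat, INR_fact_lt_0.
  - induction n as [|n IH]; [simpl; lra|].
    rewrite fact_simpl, mult_INR, Rinv_mult. simpl pow.
    apply Rmult_le_compat; try assumption.
    + left; apply Rinv_0_lt_compat, lt_0_INR; lia.
    + left; apply Rinv_0_lt_compat, INR_fact_lt_0.
    + apply Rinv_le_contravar; [lra|].
      rewrite !S_INR. pose proof (pos_INR n); lra.
Qed.

(** Strong induction on the recurrence solved for its last term: [exp1_coef i <= 2 ^ (- i)], and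
    these powers for [i] from [1] to [n] add up to less than [1]. *)
Lemma bern_coef_bound (n : nat) : Rabs (bern_coef n) <= 1.
Proof.
  induction n as [n IH] using (well_founded_induction Wf_nat.lt_wf).
  destruct n as [|m].
  - unfold bern_coef, Bernoulli; simpl. rewrite Rabs_pos_eq; lra.
  - pose proof (bern_coef_rec (S m)) as H.
    rewrite tech5, Nat.sub_diag in H. unfold delta in H; simpl (Nat.eqb _ _) in H.
    cbv iota in H.
    replace (exp1_coef 0) with 1 in H by (unfold exp1_coef; simpl; field).
    replace (bern_coef (S m)) with
      (- sum_f_R0 (fun j => bern_coef j * exp1_coef (S m - j)) m) by lra.
    rewrite Rabs_Ropp. eapply Rle_trans; [apply Rsum_abs|].
    apply Rle_trans with (sum_f_R0 (fun j => (/ 2) ^ (S m - j)) m).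
    { apply sum_Rle; intros j Hj. rewrite Rabs_mult.
      rewrite <- (Rmult_1_l ((/ 2) ^ _)).
      pose proof (exp1_coef_bound (S m - j)).
      apply Rmult_le_compat; try apply Rabs_pos; [apply IH; lia|].
      rewrite Rabs_pos_eq; lra. }
    clear. assert (Hs : sum_f_R0 (fun j => (/ 2) ^ (S m - j)) m = 1 - (/ 2) ^ S m).
    { induction m as [|m IH]; [simpl; lra|].
      rewrite tech5, Nat.sub_succ_l, Nat.sub_diag by lia.
      rewrite (sum_eq _ (fun j => (/2) ^ (S m - j) * / 2)).
      - rewrite <- scal_sum, IH. simpl; lra.
      - intros i Hi. replace (S (S m) - i)%nat with (S (S m - i)) by lia.
        simpl; ring. }
    rewrite Hs. assert (0 < (/ 2) ^ S m) by (apply pow_lt; lra). lra.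
Qed.

(** Linear growth is allowed, and not just boundedness, because the Cauchy product of two bounded
    sequences grows linearly. *)
Lemma CV_radius_gt (a : nat -> R) (M x : R) :
  (forall n, Rabs (a n) <= M * INR (S n)) -> Rabs x < 1 ->
  Rbar_lt (Rabs x) (CV_radius a).
Proof.
  intros Ha Hx. set (r := (Rabs x + 1) / 2).
  pose proof (Rabs_pos x).
  assert (Hr : Rabs x < r < 1) by (unfold r; lra).
  apply Rbar_lt_le_trans with r; [apply Hr|].
  apply (proj1 (CV_radius_bounded a)).
  exists (M * / (1 - r)). intros n.
  assert (HM : 0 <= M).
  { pose proof (Ha 0%nat) as H0. simpl in H0. pose proof (Rabs_pos (a 0%nat)); lra. }
  rewrite Rabs_mult, (Rabs_pos_eq (r ^ n)) by (apply pow_le; lra).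
  apply Rle_trans with (M * (INR (S n) * r ^ n)).
  { rewrite <- Rmult_assoc. apply Rmult_le_compat_r; [apply pow_le; lra|apply Ha]. }
  apply Rmult_le_compat_l; [assumption|].
  (* Each of the [n + 1] powers [r ^ k] is at least [r ^ n], so [(n + 1) r ^ n] is below the
     geometric sum. *)
  apply Rle_trans with (sum_f_R0 (fun k => r ^ k) n).
  - rewrite Rmult_comm, <- sum_cte. apply sum_Rle; intros k Hk.
    replace n with (k + (n - k))%nat by lia. rewrite pow_add.
    rewrite <- (Rmult_1_r (r ^ k)) at 2.
    apply Rmult_le_compat_l; [apply pow_le; lra|].
    rewrite <- (pow1 (n - k)). apply pow_incr; lra.
  - rewrite tech3 by lra. unfold Rdiv. rewrite <- (Rmult_1_l (/ (1 - r))) at 2.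
    apply Rmult_le_compat_r; [left; apply Rinv_0_lt_compat; lra|].
    assert (0 < r ^ S n) by (apply pow_lt; lra). lra.
Qed.

Lemma delta_bound (m n : nat) : Rabs (delta m n) <= 1 * INR (S n).
Proof.
  rewrite S_INR. pose proof (pos_INR n).
  unfold delta; destruct (Nat.eqb n m); rewrite Rabs_pos_eq; lra.
Qed.

Lemma PSeries_delta (m : nat) (x : R) : Rabs x < 1 -> PSeries (delta m) x = x ^ m.
Proof.
  intros Hx.
  rewrite PSeries_decr_1
    by (apply CV_radius_inside, CV_radius_gt with 1; [apply delta_bound|exact Hx]).
  revert x Hx. induction m as [|m IH]; intros x Hx.
  - rewrite (PSeries_ext _ (fun _ => 0)) by (intros n; reflexivity).
    rewrite PSeries_const_0. unfold delta; simpl; ring.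
  - rewrite (PSeries_ext _ (delta m)) by (intros n; reflexivity).
    rewrite PSeries_decr_1
      by (apply CV_radius_inside, CV_radius_gt with 1; [apply delta_bound|exact Hx]).
    rewrite IH by assumption. unfold delta; simpl; ring.
Qed.

Lemma bern_coef_bound' (n : nat) : Rabs (bern_coef n) <= 1 * INR (S n).
Proof.
  rewrite S_INR. pose proof (pos_INR n). pose proof (bern_coef_bound n). lra.
Qed.

Lemma exp1_coef_bound' (n : nat) : Rabs (exp1_coef n) <= 1 * INR (S n).
Proof.
  rewrite S_INR. pose proof (pos_INR n). pose proof (exp1_coef_bound n).
  rewrite Rabs_pos_eq by lra.
  assert ((/ 2) ^ n <= 1) by (rewrite <- (pow1 n); apply pow_incr; lra). lra.
Qed.

(** * Differential equations of the generating functions *)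

Lemma bern_exp1_mult (x : R) : Rabs x < 1 ->
  PSeries bern_coef x * PSeries exp1_coef x = 1.
Proof.
  intros Hx. rewrite <- PSeries_mult
    by (apply CV_radius_gt with 1; [apply bern_coef_bound' || apply exp1_coef_bound'|exact Hx]).
  rewrite (PSeries_ext _ (delta 0)) by (intros n; apply bern_coef_rec).
  rewrite PSeries_delta by assumption. reflexivity.
Qed.

(** For [E = (exp x - 1) / x] this is [(x E)' = exp x = 1 + x E]. *)
Lemma exp1_coef_ode (x : R) : Rabs x < 1 ->
  PSeries exp1_coef x + x * PSeries (PS_derive exp1_coef) x =
  1 + x * PSeries exp1_coef x.
Proof.
  intros Hx. rewrite <- !PSeries_incr_1.
  change 1 with (x ^ 0). rewrite <- PSeries_delta by assumption.
  pose proof (CV_radius_gt _ _ x exp1_coef_bound' Hx) as He.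
  pose proof (CV_radius_gt _ _ x (delta_bound 0) Hx) as Hd.
  rewrite <- !PSeries_plus.
  - apply PSeries_ext; intros [|n]; unfold PS_plus, PS_incr_1, PS_derive, exp1_coef, delta;
      simpl Nat.eqb; cbv iota; unfold plus, zero; simpl AbelianMonoid.sort.
    + simpl. field.
    + change (/ INR (fact (S (S n))) + INR (S n) * / INR (fact (S (S n))) =
        0 + / INR (fact (S n))).
      rewrite (fact_simpl (S n)), mult_INR, (S_INR (S n)). field.
      split; [apply INR_fact_neq_0|]. pose proof (pos_INR (S n)); lra.
  - now apply CV_radius_inside.
  - apply CV_radius_inside; now rewrite CV_radius_incr_1.
  - now apply CV_radius_inside.
  - apply CV_radius_inside; now rewrite CV_radius_incr_1, CV_radius_derive.
Qed.

(** The Taylor coefficients of [x / (exp x - 1) + x / 2 - 1 = (x / 2) coth (x / 2) - 1]. *)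
Definition coth_coef (n : nat) : R := bern_coef n + (/ 2 * delta 1 n - delta 0 n).

Lemma PSeries_coth_coef (x : R) : Rabs x < 1 ->
  PSeries coth_coef x = PSeries bern_coef x + (x / 2 - 1).
Proof.
  intros Hx.
  pose proof (CV_radius_inside _ _ (CV_radius_gt _ _ x bern_coef_bound' Hx)) as Hb.
  pose proof (fun m => CV_radius_inside _ _ (CV_radius_gt _ _ x (delta_bound m) Hx)) as Hd.
  assert (Hd' : ex_pseries (PS_scal (/ 2) (delta 1)) x)
    by (apply ex_pseries_scal; [apply Rmult_comm|apply Hd]).
  rewrite (PSeries_ext _
    (PS_plus bern_coef (PS_minus (PS_scal (/ 2) (delta 1)) (delta 0))))
    by (intros n; reflexivity).
  rewrite PSeries_plus, PSeries_minus, PSeries_scal, !PSeries_delta; try easy.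
  - simpl; field.
  - now apply ex_pseries_minus.
Qed.

Lemma coth_coef_bound (n : nat) : Rabs (coth_coef n) <= 5 / 2.
Proof.
  unfold coth_coef. eapply Rle_trans; [apply Rabs_triang|].
  pose proof (bern_coef_bound n).
  assert (Rabs (/ 2 * delta 1 n - delta 0 n) <= 3 / 2).
  { unfold delta; destruct (Nat.eqb n 1), (Nat.eqb n 0); apply Rabs_le; lra. }
  lra.
Qed.

Lemma coth_coef_bound' (n : nat) : Rabs (coth_coef n) <= 5 / 2 * INR (S n).
Proof.
  rewrite S_INR. pose proof (pos_INR n). pose proof (coth_coef_bound n). lra.
Qed.

Lemma locally_Rabs_lt_1 (x : R) : Rabs x < 1 -> locally x (fun t => Rabs t < 1).
Proof.
  intros Hx. assert (H : 0 < 1 - Rabs x) by lra.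
  exists (mkposreal _ H). intros t Ht.
  change (Rabs (t - x) < 1 - Rabs x) in Ht.
  pose proof (Rabs_triang_inv t x) as H1. simpl in *. lra.
Qed.

(** With [B = 1 / E], differentiating [B E = 1] and using the equation of [E] gives
    [x B' = B - x B - B ^ 2]. The shift by [x / 2 - 1] removes the term [x B] and leaves an equation
    invariant under [x -> - x]. *)
Lemma coth_series_riccati (x : R) : Rabs x < 1 ->
  x * PSeries (PS_derive coth_coef) x =
  x ^ 2 / 4 - PSeries coth_coef x - PSeries coth_coef x ^ 2.
Proof.
  intros Hx.
  pose proof (CV_radius_gt _ _ x bern_coef_bound' Hx) as Hb.
  pose proof (CV_radius_gt _ _ x exp1_coef_bound' Hx) as He.
  pose proof (CV_radius_gt _ _ x coth_coef_bound' Hx) as Hp.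
  set (B := PSeries bern_coef x). set (E := PSeries exp1_coef x).
  set (B' := PSeries (PS_derive bern_coef) x).
  set (E' := PSeries (PS_derive exp1_coef) x).
  assert (HBE : B * E = 1) by now apply bern_exp1_mult.
  assert (HE : E + x * E' = 1 + x * E) by now apply exp1_coef_ode.
  assert (Hd : B' * E + B * E' = 0).
  { assert (H1 : is_derive (fun t => PSeries bern_coef t * PSeries exp1_coef t) x
      (B' * E + B * E')).
    { apply is_derive_Rmult; now apply is_derive_PSeries. }
    assert (H2 : is_derive (fun t => PSeries bern_coef t * PSeries exp1_coef t) x 0).
    { apply (is_derive_ext_loc (fun _ => 1)).
      - eapply filter_imp; [|apply locally_Rabs_lt_1, Hx].
        intros t Ht. symmetry; now apply bern_exp1_mult.
      - apply is_derive_Rconst. }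
    rewrite <- (is_derive_unique _ _ _ H1). now apply is_derive_unique. }
  assert (half : is_derive (fun t : R => t / 2 - 1) x (/ 2)) by (auto_derive; [trivial|field]).
  assert (Hp' : PSeries (PS_derive coth_coef) x = B' + / 2).
  { rewrite <- Derive_PSeries by assumption. apply is_derive_unique.
    apply (is_derive_ext_loc (fun t => PSeries bern_coef t + (t / 2 - 1))).
    - eapply filter_imp; [|apply locally_Rabs_lt_1, Hx].
      intros t Ht. symmetry; now apply PSeries_coth_coef.
    - apply is_derive_Rplus; [now apply is_derive_PSeries|].
      apply half. }
  rewrite Hp', PSeries_coth_coef by assumption. fold B.
  assert (H1 : x * B' * E = - B * (1 + x * E - E)).
  { replace (x * B' * E) with (x * (B' * E)) by ring.
    replace (B' * E) with (- (B * E')) by lra.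
    replace (1 + x * E - E) with (x * E') by lra. ring. }
  assert (H2 : x * B' = B - x * B - B ^ 2).
  { replace (x * B') with (x * B' * E * B) by (rewrite Rmult_assoc, (Rmult_comm E), HBE; ring).
    rewrite H1.
    replace (- B * (1 + x * E - E) * B) with
      (- B ^ 2 - x * B * (B * E) + B * (B * E)) by ring.
    rewrite HBE; ring. }
  replace (x * (B' + / 2)) with (x * B' + x / 2) by field. rewrite H2. field.
Qed.

(** Comparison of coefficients in the Riccati equation; the factor [n + 1] collects [x p'] and [p].
    Since [coth_coef 0 = 0], the convolution only involves smaller indices, so this is a
    recursion. *)
Lemma coth_coef_quadratic (n : nat) :
  (INR n + 1) * coth_coef n =
  / 4 * delta 2 n - sum_f_R0 (fun j => coth_coef j * coth_coef (n - j)) n.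
Proof.
  pose proof (fun x => CV_radius_gt _ _ x coth_coef_bound') as Hp.
  pose proof (fun x => CV_radius_gt _ _ x (delta_bound 2)) as Hd.
  assert (Hm : forall n, Rabs (PS_mult coth_coef coth_coef n) <= 25 / 4 * INR (S n)).
  { intros m. unfold PS_mult. eapply Rle_trans; [apply Rsum_abs|].
    rewrite <- sum_cte. apply sum_Rle; intros k Hk. rewrite Rabs_mult.
    replace (25 / 4) with (5 / 2 * (5 / 2)) by field.
    apply Rmult_le_compat; try apply Rabs_pos; apply coth_coef_bound. }
  pose proof (fun x => CV_radius_gt _ _ x Hm) as Hmm.
  set (rhs := PS_minus (PS_minus (PS_scal (/ 4) (delta 2)) coth_coef)
                (PS_mult coth_coef coth_coef)).
  (* [9 = 1 / 4 + 5 / 2 + 25 / 4], one summand for each part of [rhs]. *)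
  assert (Hr : forall m, Rabs (rhs m) <= 9 * INR (S m)).
  { intros m. unfold rhs.
    change (Rabs ((/ 4 * delta 2 m - coth_coef m) - PS_mult coth_coef coth_coef m)
      <= 9 * INR (S m)).
    pose proof (Hm m) as H1. pose proof (coth_coef_bound' m) as H2.
    pose proof (delta_bound 2 m) as H3.
    apply Rabs_le_between in H1, H2, H3. apply Rabs_le. lra. }
  assert (H0 : Rabs 0 < 1) by (rewrite Rabs_R0; lra).
  assert (H : PS_incr_1 (PS_derive coth_coef) n = rhs n).
  { apply PSeries_ext_recip.
    - rewrite CV_radius_incr_1, CV_radius_derive. rewrite <- Rabs_R0. now apply Hp.
    - rewrite <- Rabs_R0. now apply (CV_radius_gt _ _ _ Hr).
    - eapply filter_imp; [|apply locally_Rabs_lt_1, H0].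
      intros x Hx. simpl in Hx. rewrite PSeries_incr_1, coth_series_riccati by assumption.
      specialize (Hp x Hx). specialize (Hd x Hx). specialize (Hmm x Hx).
      apply CV_radius_inside in Hmm as Hmm'. apply CV_radius_inside in Hp as Hp'.
      assert (Hd' : ex_pseries (PS_scal (/ 4) (delta 2)) x)
        by (apply ex_pseries_scal; [apply Rmult_comm|now apply CV_radius_inside]).
      unfold rhs. rewrite !PSeries_minus, PSeries_mult, PSeries_scal,
        PSeries_delta; try assumption.
      + field.
      + now apply ex_pseries_minus. }
  assert (H1 : INR n * coth_coef n = PS_incr_1 (PS_derive coth_coef) n).
  { destruct n as [|n]; [|reflexivity].
    change (INR 0 * coth_coef 0 = 0). simpl; ring. }
  rewrite Rmult_plus_distr_r, H1, H.
  change (((/ 4 * delta 2 n - coth_coef n) - PS_mult coth_coef coth_coef n)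
    + 1 * coth_coef n = / 4 * delta 2 n - PS_mult coth_coef coth_coef n).
  ring.
Qed.

Lemma coth_coef_0 : coth_coef 0 = 0.
Proof. unfold coth_coef, bern_coef, Bernoulli, delta; simpl; field. Qed.

(** For odd [n], one of [j] and [n - j] is odd in every product of the recursion, so induction
    applies; the products containing [coth_coef n] itself have the other factor
    [coth_coef 0 = 0]. *)
Lemma coth_coef_odd (n : nat) : Nat.odd n = true -> coth_coef n = 0.
Proof.
  induction n as [n IH] using (well_founded_induction Wf_nat.lt_wf). intros Hn.
  assert (Hn0 : 0 < INR n + 1) by (pose proof (pos_INR n); lra).
  apply Rmult_eq_reg_l with (INR n + 1); [|lra].
  rewrite coth_coef_quadratic, Rmult_0_r.
  replace (delta 2 n) with 0.
  2: { unfold delta. destruct (Nat.eqb_spec n 2) as [->|]; [discriminate|reflexivity]. }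
  rewrite (sum_eq _ (fun _ => 0)), sum_cte; [ring|].
  intros j Hj. destruct (Nat.odd j) eqn:Hoj.
  - destruct (Nat.eq_dec j n) as [->|Hne].
    + rewrite Nat.sub_diag, coth_coef_0; ring.
    + rewrite (IH j); [ring|lia|assumption].
  - destruct (Nat.eq_dec j 0) as [->|Hne]; [rewrite coth_coef_0; ring|].
    rewrite (IH (n - j)%nat); [ring|lia|].
    rewrite Nat.odd_sub by lia. now rewrite Hn, Hoj.
Qed.

(** The Taylor coefficients of [1 - (x / 2) cot (x / 2)]. *)
Definition cot_coef (n : nat) : R := (-1) ^ S (Nat.div2 n) * coth_coef n.

(** Replacing [x] by [i x] turns the minus sign of the recursion into a plus. On even indices
    [Nat.div2] is additive, so the signs of [j] and [n - j] multiply to the right one; odd indices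
    contribute zero. *)
Lemma cot_coef_quadratic (n : nat) :
  (INR n + 1) * cot_coef n =
  / 4 * delta 2 n + sum_f_R0 (fun j => cot_coef j * cot_coef (n - j)) n.
Proof.
  destruct (Nat.odd n) eqn:Hn.
  - assert (Hz : forall j, Nat.odd j = true -> cot_coef j = 0)
      by (intros j Hj; unfold cot_coef; rewrite coth_coef_odd by assumption; ring).
    rewrite Hz by assumption. rewrite (sum_eq _ (fun _ => 0)), sum_cte.
    + unfold delta. destruct (Nat.eqb_spec n 2) as [->|]; [discriminate|ring].
    + intros j Hj. destruct (Nat.odd j) eqn:Hoj; [rewrite Hz by assumption; ring|].
      rewrite (Hz (n - j)%nat); [ring|].
      rewrite Nat.odd_sub by lia. now rewrite Hn, Hoj.
  - unfold cot_coef at 1.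
    replace ((INR n + 1) * ((-1) ^ S (Nat.div2 n) * coth_coef n)) with
      ((-1) ^ S (Nat.div2 n) * ((INR n + 1) * coth_coef n)) by ring.
    rewrite coth_coef_quadratic, Rmult_minus_distr_l.
    unfold Rminus. f_equal.
    + unfold delta. destruct (Nat.eqb_spec n 2) as [->|]; simpl; ring.
    + rewrite scal_sum, <- (Rmult_1_l (sum_f_R0 _ n)), <- Ropp_mult_distr_l_reverse, scal_sum.
      apply sum_eq; intros j Hj. unfold cot_coef.
      destruct (Nat.odd j) eqn:Hoj; [rewrite (coth_coef_odd j) by assumption; ring|].
      assert (Hd : Nat.div2 n = (Nat.div2 j + Nat.div2 (n - j))%nat).
      { pose proof (Nat.div2_odd n). pose proof (Nat.div2_odd j).
        pose proof (Nat.div2_odd (n - j)) as Hnj. rewrite Nat.odd_sub, Hn, Hoj in Hnj by lia.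
        rewrite Hn in *. rewrite Hoj in *. simpl in *. lia. }
      rewrite Hd. simpl pow. rewrite pow_add. ring.
Qed.

Lemma cot_coef_0 : cot_coef 0 = 0.
Proof. unfold cot_coef. rewrite coth_coef_0; ring. Qed.

(** The recursion has no negative term left, and its two end terms vanish with [cot_coef 0]. *)
Lemma cot_coef_pos (n : nat) : 0 <= cot_coef n.
Proof.
  induction n as [n IH] using (well_founded_induction Wf_nat.lt_wf).
  apply Rmult_le_reg_l with (INR n + 1); [pose proof (pos_INR n); lra|].
  rewrite cot_coef_quadratic, Rmult_0_r. apply Rplus_le_le_0_compat.
  - unfold delta; destruct (Nat.eqb n 2); lra.
  - rewrite <- (Rmult_0_l (INR (S n))), <- sum_cte. apply sum_Rle; intros j Hj.
    destruct (Nat.eq_dec j 0) as [->|H0]; [rewrite cot_coef_0; lra|].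
    destruct (Nat.eq_dec j n) as [->|Hne]; [rewrite Nat.sub_diag, cot_coef_0; lra|].
    apply Rmult_le_pos; apply IH; lia.
Qed.

Lemma Rabs_coth_coef (n : nat) : Rabs (coth_coef n) = cot_coef n.
Proof.
  rewrite <- (Rabs_pos_eq (cot_coef n)) by apply cot_coef_pos.
  unfold cot_coef. now rewrite Rabs_mult, pow_1_abs, Rmult_1_l.
Qed.

(** * The cotangent series *)

Lemma is_derive_le (f f' : R -> R) (a b : R) :
  a <= b -> (forall t, a <= t <= b -> is_derive f t (f' t)) ->
  (forall t, a < t < b -> 0 <= f' t) -> f a <= f b.
Proof.
  intros Hab Hd Hp. destruct (Rle_lt_or_eq_dec _ _ Hab) as [H|<-]; [|lra].
  destruct (MVT_cor2 f f' a b H) as [c [Hc1 Hc2]].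
  - intros t Ht. now apply is_derive_Reals, Hd.
  - specialize (Hp c Hc2). nra.
Qed.

Lemma is_derive_sum_f_R0 (f : nat -> R -> R) (d : nat -> R) (x : R) (N : nat) :
  (forall k, is_derive (f k) x (d k)) ->
  is_derive (fun t => sum_f_R0 (fun k => f k t) N) x (sum_f_R0 d N).
Proof.
  intros H. induction N as [|N IH]; [apply H|].
  simpl. now apply is_derive_Rplus.
Qed.

Lemma is_derive_monomial (c : R) (n : nat) (x : R) :
  is_derive (fun t => c * t ^ n) x (c * (INR n * x ^ pred n)).
Proof. auto_derive; [trivial|ring]. Qed.

Lemma sum_f_R0_nonneg (a : nat -> R) (N : nat) :
  (forall n, 0 <= a n) -> 0 <= sum_f_R0 a N.
Proof. intros H. induction N as [|N IH]; simpl; [apply H|]. specialize (H (S N)). lra. Qed.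

Lemma is_lim_seq_inv_INR_S : is_lim_seq (fun k => / INR (S k)) 0.
Proof.
  apply (is_lim_seq_incr_1 (fun k => / INR k)).
  replace (Finite 0) with (Rbar_inv p_infty) by reflexivity.
  apply is_lim_seq_inv; [apply is_lim_seq_INR|discriminate].
Qed.

Lemma inv_INR_S_bound (k : nat) : 0 < / INR (S k) <= 1.
Proof.
  split; [apply Rinv_0_lt_compat, lt_0_INR; lia|].
  rewrite <- Rinv_1. apply Rinv_le_contravar; [lra|].
  rewrite S_INR; pose proof (pos_INR k); lra.
Qed.

Lemma ex_series_nonneg (a : nat -> R) (M : R) :
  (forall n, 0 <= a n) -> (forall N, sum_f_R0 a N <= M) -> ex_series a.
Proof.
  intros Ha HM.
  assert (H : ex_finite_lim_seq (fun N => sum_n a N)).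
  { apply ex_finite_lim_seq_incr with M.
    - intros n. rewrite sum_Sn. unfold plus; simpl. specialize (Ha (S n)). lra.
    - intros n. rewrite sum_n_Reals. apply HM. }
  destruct H as [l Hl]. now exists l.
Qed.

(** The square contains all products [a i * a j] with [i, j <= N]; the left side keeps only those
    with [i + j <= N]. *)
Lemma Cauchy_prod_sum_le (a : nat -> R) (N : nat) :
  (forall n, 0 <= a n) ->
  sum_f_R0 (fun n => sum_f_R0 (fun j => a j * a (n - j)%nat) n) N <= sum_f_R0 a N ^ 2.
Proof.
  intros Ha. destruct N as [|N]; [simpl; lra|].
  rewrite <- Rsqr_pow2. unfold Rsqr. rewrite cauchy_finite by lia.
  match goal with |- ?x <= ?x + ?y => enough (0 <= y) by lra end.
  apply sum_f_R0_nonneg; intros k. apply sum_f_R0_nonneg; intros l.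
  apply Rmult_le_pos; apply Ha.
Qed.

(** * Comparison of the partial sums with the cotangent *)

Lemma mul_cos_le_sin (s : R) : 0 <= s <= PI -> s * cos s <= sin s.
Proof.
  intros Hs.
  enough (sin 0 - 0 * cos 0 <= sin s - s * cos s) by (rewrite sin_0 in *; lra).
  apply (is_derive_le (fun t => sin t - t * cos t) (fun t => t * sin t)); [lra| |].
  - intros t Ht. auto_derive; [trivial|ring].
  - intros t Ht. apply Rmult_le_pos; [lra|]. apply sin_ge_0; lra.
Qed.

Definition cot_sum (N : nat) (x : R) : R := sum_f_R0 (fun n => cot_coef n * x ^ n) N.

Definition cot_fun (x : R) : R := 1 - x / 2 * cos (x / 2) / sin (x / 2).

Lemma sin_half_pos (x : R) : 0 < x < 2 * PI -> 0 < sin (x / 2).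
Proof. intros Hx. apply sin_gt_0; lra. Qed.

Lemma cot_fun_pos (x : R) : 0 < x < 2 * PI -> 0 <= cot_fun x.
Proof.
  intros Hx. unfold cot_fun. pose proof (sin_half_pos x Hx).
  pose proof (mul_cos_le_sin (x / 2)) as H1.
  enough (x / 2 * cos (x / 2) / sin (x / 2) <= 1) by lra.
  apply Rle_div_l; lra.
Qed.

(** The analytic counterpart of [cot_coef_quadratic]: [x f' + f = x ^ 2 / 4 + f ^ 2] for
    [f = cot_fun]. *)
Lemma is_derive_cot_fun (x : R) : 0 < x < 2 * PI ->
  is_derive (fun t => t * cot_fun t) x (x ^ 2 / 4 + cot_fun x ^ 2).
Proof.
  intros Hx. pose proof (sin_half_pos x Hx) as Hs. unfold cot_fun.
  auto_derive; [unfold Rdiv in Hs; lra|].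
  change (x * / 2) with (x / 2).
  assert (H2 : (sin (x / 2)) ^ 2 = 1 - cos (x / 2) ^ 2)
    by (pose proof (sin2_cos2 (x / 2)) as H2; unfold Rsqr in H2; lra).
  set (s := sin (x / 2)) in *. set (c := cos (x / 2)) in *.
  apply Rmult_eq_reg_r with (s ^ 2); [|nra].
  field_simplify; [|lra..]. rewrite ?H2.
  replace (s ^ 3) with (s * s ^ 2) by ring. rewrite ?H2. field.
Qed.

(** The left side may run to [S N] although only [cot_sum N] is squared: as [cot_coef 0 = 0], the
    coefficients up to [S N] of the square use indices at most [N]. This gain of one index drives
    the induction in [cot_sum_le]. *)
Lemma cot_sum_quadratic (N : nat) (x : R) : 0 <= x ->
  sum_f_R0 (fun n => cot_coef n * (INR (S n) * x ^ n)) (S N) <=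
  x ^ 2 / 4 + cot_sum N x ^ 2.
Proof.
  intros Hx.
  (* Truncating at [N] lets [Cauchy_prod_sum_le] be used up to [S N] while the sum itself stays
     [cot_sum N x]. *)
  set (a := fun n => if Nat.leb n N then cot_coef n * x ^ n else 0).
  assert (Ha : forall n, 0 <= a n).
  { intros n. unfold a. destruct (Nat.leb n N); [|lra].
    apply Rmult_le_pos; [apply cot_coef_pos|now apply pow_le]. }
  assert (Hs : sum_f_R0 a (S N) = cot_sum N x).
  { rewrite tech5. unfold a at 2. rewrite (proj2 (Nat.leb_gt (S N) N)), Rplus_0_r by lia.
    apply sum_eq; intros i Hi. unfold a. now rewrite (proj2 (Nat.leb_le i N)). }
  rewrite <- Hs.
  eapply Rle_trans; [|apply Rplus_le_compat_l, Cauchy_prod_sum_le, Ha].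
  rewrite (sum_eq _ (fun n => / 4 * delta 2 n * x ^ n +
    sum_f_R0 (fun j => a j * a (n - j)%nat) n)).
  - rewrite sum_plus. apply Rplus_le_compat_r.
    clear. assert (0 <= x ^ 2) by apply pow2_ge_0.
    (* For [N = 0] the sum stops before the index [2] and is zero; otherwise it is exactly
       [x ^ 2 / 4]. *)
    assert (H1 : forall M, (M < 2)%nat -> sum_f_R0 (fun n => / 4 * delta 2 n * x ^ n) M = 0).
    { intros [|[|M]] HM; [| |lia]; unfold delta; simpl; ring. }
    destruct N as [|N]; [rewrite H1 by lia; lra|].
    induction N as [|N IH]; [rewrite tech5, H1 by lia; unfold delta; simpl; lra|].
    rewrite tech5. unfold delta at 2. simpl Nat.eqb. lra.
  - intros n Hn. rewrite S_INR.
    replace (cot_coef n * ((INR n + 1) * x ^ n)) with ((INR n + 1) * cot_coef n * x ^ n) by ring.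
    rewrite cot_coef_quadratic, Rmult_plus_distr_r. f_equal.
    rewrite Rmult_comm, scal_sum. apply sum_eq; intros j Hj. unfold a.
    destruct (Nat.eq_dec j (S N)) as [->|H1].
    { replace (n - S N)%nat with 0%nat by lia. simpl (0 <=? N)%nat. rewrite cot_coef_0; ring. }
    destruct (Nat.eq_dec j 0) as [->|H2].
    { rewrite cot_coef_0. destruct (0 <=? N)%nat; ring. }
    rewrite (proj2 (Nat.leb_le j N)), (proj2 (Nat.leb_le (n - j) N)) by lia.
    replace n with (j + (n - j))%nat at 2 by lia. rewrite pow_add; ring.
Qed.

Lemma cot_sum_incr (N : nat) (x y : R) : 0 <= x <= y -> cot_sum N x <= cot_sum N y.
Proof.
  intros Hx. apply sum_Rle; intros n _. apply Rmult_le_compat_l; [apply cot_coef_pos|].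
  now apply pow_incr.
Qed.

Lemma cot_sum_nonneg (N : nat) (x : R) : 0 <= x -> 0 <= cot_sum N x.
Proof.
  intros Hx. apply sum_f_R0_nonneg; intros n.
  apply Rmult_le_pos; [apply cot_coef_pos|now apply pow_le].
Qed.

(* [x * cot_fun x] solves [g' = x^2/4 + (g/x)^2], of which the partial sums are subsolutions. *)
Lemma cot_sum_le (N : nat) (x : R) : 0 < x < 2 * PI -> cot_sum N x <= cot_fun x.
Proof.
  revert x. induction N as [|N IH]; intros x Hx.
  - unfold cot_sum; simpl. rewrite cot_coef_0. pose proof (cot_fun_pos x Hx). lra.
  - set (F := fun t => t * cot_fun t - sum_f_R0 (fun n => cot_coef n * t ^ S n) (S N)).
    assert (HF : forall t, F t = t * (cot_fun t - cot_sum (S N) t)).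
    { intros t. unfold F, cot_sum. rewrite Rmult_minus_distr_l, scal_sum. f_equal.
      apply sum_eq; intros n _. simpl; ring. }
    assert (Hinc : forall t, 0 < t <= x -> F t <= F x).
    { intros t Ht. apply (is_derive_le F (fun u => (u ^ 2 / 4 + cot_fun u ^ 2) -
        sum_f_R0 (fun n => cot_coef n * (INR (S n) * u ^ n)) (S N))); [lra| |].
      - intros u Hu. apply is_derive_Rminus; [apply is_derive_cot_fun; lra|].
        apply (is_derive_sum_f_R0 (fun n t => cot_coef n * t ^ S n)); intros k.
        apply (is_derive_monomial _ (S k)).
      - intros u Hu. pose proof (cot_sum_quadratic N u) as H.
        assert (cot_sum N u ^ 2 <= cot_fun u ^ 2).
        { apply pow_incr. split; [apply cot_sum_nonneg; lra|apply IH; lra]. }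
        lra. }
    (* [F] increases and is at least [- t * cot_sum (S N) x] near [0]. This replaces its limit at
       [0], where [cot_fun] has a zero denominator. *)
    assert (Hlow : forall t, 0 < t <= x -> - (t * cot_sum (S N) x) <= F x).
    { intros t Ht. eapply Rle_trans; [|now apply Hinc]. rewrite HF.
      pose proof (cot_fun_pos t). pose proof (cot_sum_incr (S N) t x). nra. }
    assert (H0 : 0 <= F x).
    { apply Rnot_lt_le; intros Hneg.
      pose proof (cot_sum_nonneg (S N) x) as Hq.
      (* Chosen so that [t = - F x / K] contradicts [Hlow]: [K >= - F x / x] gives [t <= x], and
         [K > cot_sum (S N) x] gives [t * cot_sum (S N) x < - F x]. *)
      set (K := cot_sum (S N) x + 1 - F x / x) in *.
      assert (0 < - F x / x) by (apply Rdiv_lt_0_compat; lra).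
      assert (HK : 0 < K) by (unfold K, Rdiv in *; lra).
      assert (Ht : 0 < - F x / K) by (apply Rdiv_lt_0_compat; lra).
      assert (Ht' : - F x / K <= x).
      { apply Rle_div_l; [lra|]. unfold K. rewrite Rmult_minus_distr_l.
        replace (x * (F x / x)) with (F x) by (field; lra). nra. }
      specialize (Hlow _ (conj Ht Ht')).
      assert (- F x / K * cot_sum (S N) x < - F x).
      { replace (- F x / K * cot_sum (S N) x) with (- F x * (cot_sum (S N) x / K))
          by (field; lra).
        rewrite <- (Rmult_1_r (- F x)) at 2. apply Rmult_lt_compat_l; [lra|].
        apply Rlt_div_l; [lra|]. unfold K, Rdiv in *; lra. }
      lra. }
    rewrite HF in H0. nra.
Qed.

(** The simple pole at [2 * PI], uniformly in [N]. The sum is [cot_sum N x / x], and [pred 0] is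
    harmless because [cot_coef 0 = 0]. *)
Lemma cot_sum_bound (N : nat) (x : R) : 0 < x < 2 * PI ->
  sum_f_R0 (fun n => cot_coef n * x ^ pred n) N <= 3 / (2 * PI - x).
Proof.
  intros Hx. pose proof PI_RGT_0 as Hpi.
  assert (Hq : forall t, 0 < t -> sum_f_R0 (fun n => cot_coef n * t ^ pred n) N = cot_sum N t / t).
  { intros t Ht. unfold cot_sum, Rdiv. rewrite Rmult_comm, scal_sum.
    apply sum_eq; intros [|n] _; [rewrite cot_coef_0; ring|]. simpl; field; lra. }
  (* Below [PI] the sum is at most its value at [PI], where [cot_fun PI = 1]. Above,
     [s = PI - x / 2] reduces the claim to [s + PI <= 3 * x / 2], which holds exactly when
     [x >= PI]: hence the constant 3. *)
  destruct (Rle_dec x PI) as [Hle|Hgt].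
  - apply Rle_trans with (sum_f_R0 (fun n => cot_coef n * PI ^ pred n) N).
    { apply sum_Rle; intros n _. apply Rmult_le_compat_l; [apply cot_coef_pos|].
      apply pow_incr; lra. }
    rewrite Hq by assumption.
    assert (H1 : cot_sum N PI <= 1).
    { eapply Rle_trans; [apply cot_sum_le; lra|].
      unfold cot_fun. rewrite cos_PI2. unfold Rdiv; lra. }
    apply Rle_div_l; [lra|].
    apply Rle_trans with 1; [assumption|].
    replace (3 / (2 * PI - x) * PI) with (3 * PI / (2 * PI - x)) by (field; lra).
    apply Rle_div_r; lra.
  - rewrite Hq by lra.
    set (s := PI - x / 2).
    assert (Hs : 0 < s <= PI / 2) by (unfold s; lra).
    assert (H1 : cot_fun x <= 1 + PI / s).
    { unfold cot_fun. replace (x / 2) with (PI - s) by (unfold s; lra).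
      rewrite sin_PI_x, cos_minus, cos_PI, sin_PI.
      pose proof (mul_cos_le_sin s ltac:(lra)) as H.
      assert (Hsin : 0 < sin s) by (apply sin_gt_0; lra).
      assert (Hcos : 0 <= cos s) by (apply cos_ge_0; lra).
      assert (cos s / sin s <= / s).
      { apply Rle_div_l; [lra|]. apply Rmult_le_reg_l with s; [lra|].
        rewrite <- Rmult_assoc, Rinv_r by lra. lra. }
      replace (1 - (PI - s) * (-1 * cos s + 0 * sin s) / sin s) with
        (1 + (PI - s) * (cos s / sin s)) by (field; lra).
      apply Rplus_le_compat_l. unfold Rdiv at 2.
      apply Rmult_le_compat; try lra. unfold Rdiv.
      apply Rmult_le_pos; [lra|]. left; now apply Rinv_0_lt_compat. }
    apply Rle_div_l; [lra|].
    eapply Rle_trans; [apply cot_sum_le; assumption|].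
    eapply Rle_trans; [apply H1|].
    replace (3 / (2 * PI - x) * x) with (3 * (x / 2) / s) by (unfold s; field; lra).
    apply Rle_div_r; [lra|].
    replace ((1 + PI / s) * s) with (s + PI) by (field; lra). unfold s; lra.
Qed.

Lemma ex_series_cot_coef (x : R) : 0 <= x < 2 * PI -> ex_series (fun n => cot_coef n * x ^ n).
Proof.
  intros Hx.
  (* The midpoint is positive even for [x = 0], where [cot_sum_le] does not apply. *)
  apply ex_series_nonneg with (cot_fun ((x + 2 * PI) / 2)).
  - intros n. apply Rmult_le_pos; [apply cot_coef_pos|apply pow_le; lra].
  - intros N. eapply Rle_trans; [apply (cot_sum_incr N x ((x + 2 * PI) / 2)); lra|].
    apply cot_sum_le; lra.
Qed.

(** [cot_sum_bound] is integrated twice from [0], as two comparisons of derivatives, with bounds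
    that do not depend on [N]. *)
Lemma ex_series_cot_coef_boundary :
  ex_series (fun n => cot_coef n / (INR n * INR (S n)) * (2 * PI) ^ S n).
Proof.
  pose proof PI_RGT_0 as Hpi.
  set (c := fun n => cot_coef n / (INR n * INR (S n))).
  assert (Hc : forall n, 0 <= c n).
  { intros [|n]; unfold c; [rewrite cot_coef_0; unfold Rdiv; lra|].
    apply Rdiv_le_0_compat; [apply cot_coef_pos|].
    apply Rmult_lt_0_compat; apply lt_0_INR; lia. }
  assert (Hc' : forall n, c n * (INR (S n) * INR n) = cot_coef n).
  { intros [|n]; [rewrite cot_coef_0; simpl; ring|]. unfold c. field.
    split; apply not_0_INR; lia. }
  set (J := fun N x => sum_f_R0 (fun n => c n * x ^ S n) N).
  set (J' := fun N x => sum_f_R0 (fun n => c n * (INR (S n) * x ^ n)) N).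
  assert (HJ : forall N x, is_derive (J N) x (J' N x)).
  { intros N x. apply (is_derive_sum_f_R0 (fun n t => c n * t ^ S n)); intros k.
    apply (is_derive_monomial _ (S k)). }
  assert (HJ' : forall N x,
    is_derive (J' N) x (sum_f_R0 (fun n => cot_coef n * x ^ pred n) N)).
  { intros N x. apply (is_derive_sum_f_R0 (fun n t => c n * (INR (S n) * t ^ n))); intros k.
    rewrite <- Hc'.
    apply (is_derive_ext (fun t => c k * INR (S k) * t ^ k)); [intros t; apply Rmult_assoc|].
    replace (c k * (INR (S k) * INR k) * x ^ pred k) with
      (c k * INR (S k) * (INR k * x ^ pred k)) by ring.
    apply is_derive_monomial. }
  (* A second antiderivative of [3 / (2 PI - x)], bounded near [2 PI] because [t ln t] is. *)
  set (M := fun x => 3 * ((2 * PI - x) * ln (2 * PI - x) - (2 * PI - x))).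
  set (M' := fun x => - 3 * ln (2 * PI - x)).
  assert (HM : forall x, x < 2 * PI -> is_derive M x (M' x)).
  { intros x Hx. unfold M, M'. auto_derive; [lra|].
    change (2 * PI + - x) with (2 * PI - x); field; lra. }
  assert (HM' : forall x, x < 2 * PI -> is_derive M' x (3 / (2 * PI - x))).
  { intros x Hx. unfold M'. auto_derive; [lra|field; lra]. }
  assert (HJ0 : forall N, J' N 0 = 0).
  { intros N. unfold J'. rewrite (sum_eq _ (fun _ => 0)), sum_cte; [ring|].
    intros [|n] _; [unfold c; rewrite cot_coef_0; simpl; unfold Rdiv; ring|].
    simpl pow; ring. }
  assert (B1 : forall N x, 0 <= x < 2 * PI -> J' N x <= M' x - M' 0).
  { intros N x Hx. enough (M' 0 - J' N 0 <= M' x - J' N x) by (rewrite HJ0 in *; lra).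
    apply (is_derive_le (fun t => M' t - J' N t) (fun t => 3 / (2 * PI - t) -
      sum_f_R0 (fun n => cot_coef n * t ^ pred n) N)); [lra| |].
    - intros t Ht. apply is_derive_Rminus; [apply HM'; lra|apply HJ'].
    - intros t Ht. pose proof (cot_sum_bound N t). lra. }
  assert (B2 : forall N x, 0 <= x < 2 * PI -> J N x <= M x - M 0 - x * M' 0).
  { intros N x Hx.
    assert (HJ00 : J N 0 = 0).
    { unfold J. rewrite (sum_eq _ (fun _ => 0)), sum_cte; [ring|].
      intros n _. simpl pow; ring. }
    enough (M 0 - 0 * M' 0 - J N 0 <= M x - x * M' 0 - J N x) by lra.
    apply (is_derive_le (fun t => M t - t * M' 0 - J N t)
      (fun t => M' t - M' 0 - J' N t)); [lra| |].
    - intros t Ht. apply is_derive_Rminus; [|apply HJ].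
      apply is_derive_Rminus; [apply HM; lra|]. auto_derive; [trivial|ring].
    - intros t Ht. pose proof (B1 N t). lra. }
  (* A generous choice: once [ln (2 PI - x)] is replaced by [ln (2 PI)], the right side of [B2]
     collapses to [3 * x]. *)
  set (K := 6 * PI * ln (2 * PI) + 6 * PI).
  assert (Hln : 0 < ln (2 * PI)).
  { rewrite <- ln_1. apply ln_increasing; [lra|]. pose proof PI2_1. lra. }
  assert (B3 : forall N x, 0 <= x < 2 * PI -> J N x <= K).
  { intros N x Hx. eapply Rle_trans; [now apply B2|]. unfold M, M', K. rewrite Rminus_0_r.
    assert (ln (2 * PI - x) <= ln (2 * PI)).
    { destruct (Req_dec x 0) as [->|]; [rewrite Rminus_0_r; lra|].
      left; apply ln_increasing; lra. }
    assert ((2 * PI - x) * ln (2 * PI - x) <= (2 * PI - x) * ln (2 * PI))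
      by (apply Rmult_le_compat_l; lra).
    nra. }
  apply ex_series_nonneg with K.
  - intros n. apply Rmult_le_pos; [apply Hc|apply pow_le; lra].
  - intros N. change (J N (2 * PI) <= K).
    (* The bound holds only left of [2 PI]; the polynomial [J N] carries it to [2 PI] by
       continuity. *)
    assert (Hl : is_lim_seq (fun k => J N (2 * PI - / INR (S k))) (J N (2 * PI))).
    { apply (is_lim_seq_continuous (J N)).
      - apply derivable_continuous_pt. exists (J' N (2 * PI)). now apply is_derive_Reals.
      - replace (Finite (2 * PI)) with (Finite (2 * PI - 0)) by (f_equal; ring).
        apply is_lim_seq_minus'; [apply is_lim_seq_const|].
        apply is_lim_seq_inv_INR_S. }
    refine (is_lim_seq_le _ (fun _ => K) (J N (2 * PI)) K _ Hl (is_lim_seq_const K)).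
    intros k. apply B3.
    pose proof (inv_INR_S_bound k). pose proof PI2_1. lra.
Qed.

(** * Dominated series *)

Lemma filterlim_sum_f_R0 {T : Type} (F : (T -> Prop) -> Prop) {FF : Filter F}
  (f : nat -> T -> R) (l : nat -> R) (N : nat) :
  (forall k, filterlim (f k) F (locally (l k))) ->
  filterlim (fun x => sum_f_R0 (fun k => f k x) N) F (locally (sum_f_R0 l N)).
Proof.
  intros Hf. induction N as [|N IH]; [apply Hf|]. simpl.
  eapply filterlim_comp_2; [exact IH|apply Hf|].
  apply (filterlim_plus (K := R_AbsRing) (V := R_NormedModule)).
Qed.

Lemma Series_split (a : nat -> R) (N : nat) : ex_series a ->
  Series a = sum_f_R0 a N + Series (fun k => a (S N + k)%nat).
Proof. intros H. apply (Series_incr_n a (S N)); [lia|exact H]. Qed.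

Lemma Series_tail (M : nat -> R) (eps : posreal) : ex_series M ->
  exists N, Rabs (Series (fun k => M (S N + k)%nat)) < eps.
Proof.
  intros HM. pose proof (Series_correct M HM) as Hl.
  apply is_series_Reals in Hl. destruct (Hl eps (cond_pos eps)) as [N HN].
  exists N. specialize (HN N (Nat.le_refl _)). unfold Rdist in HN.
  rewrite (Series_split M N HM) in HN. rewrite <- Rabs_Ropp. simpl in *.
  eapply Rle_lt_trans; [|exact HN]. right; f_equal; simpl; ring.
Qed.

Lemma ex_series_dominated (a M : nat -> R) :
  (forall k, Rabs (a k) <= M k) -> ex_series M -> ex_series a.
Proof. intros H HM. exact (ex_series_le (V := R_CompleteNormedModule) a M H HM). Qed.

Lemma Series_dominated (a M : nat -> R) :
  (forall k, Rabs (a k) <= M k) -> ex_series M -> Rabs (Series a) <= Series M.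
Proof.
  intros H HM. eapply Rle_trans.
  - apply Series_Rabs. apply ex_series_dominated with M; [|exact HM].
    intros k; now rewrite Rabs_Rabsolu.
  - apply Series_le; [|exact HM]. intros k; split; [apply Rabs_pos|apply H].
Qed.

(* Tannery's theorem. *)
Lemma filterlim_Series {T : Type} (F : (T -> Prop) -> Prop) {FF : Filter F}
  (f : nat -> T -> R) (l M : nat -> R) :
  (forall k, filterlim (f k) F (locally (l k))) ->
  F (fun x => forall k, Rabs (f k x) <= M k) -> (forall k, Rabs (l k) <= M k) ->
  ex_series M ->
  filterlim (fun x => Series (fun k => f k x)) F (locally (Series l)).
Proof.
  intros Hf HfM HlM HM. apply filterlim_locally; intros eps.
  assert (He : 0 < eps / 3) by (destruct eps; simpl; lra).
  destruct (Series_tail M (mkposreal _ He) HM) as [N HN]. simpl in HN.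
  pose proof (filterlim_sum_f_R0 F f l N Hf) as Hs.
  pose proof (proj1 (filterlim_locally _ _) Hs (mkposreal _ He)) as Hs'.
  assert (HM' : ex_series (fun k => M (S N + k)%nat))
    by (apply (ex_series_incr_n (V := R_NormedModule) M (S N)), HM).
  generalize (filter_and _ _ HfM Hs'). apply filter_imp. intros x [H1 H2].
  change (Rabs (sum_f_R0 (fun k => f k x) N - sum_f_R0 l N) < eps / 3) in H2.
  change (Rabs (Series (fun k => f k x) - Series l) < eps).
  rewrite (Series_split (fun k => f k x) N) by now apply ex_series_dominated with M.
  rewrite (Series_split l N) by now apply ex_series_dominated with M.
  pose proof (Series_dominated (fun k => f (S N + k)%nat x) _ (fun k => H1 _) HM') as H3.
  pose proof (Series_dominated (fun k => l (S N + k)%nat) _ (fun k => HlM _) HM') as H4.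
  apply Rabs_le_between in H3, H4. apply Rabs_lt_between in HN, H2.
  apply Rabs_lt_between. cbv beta in *. simpl Nat.add in *. lra.
Qed.

(** Puts the derivative in the form of a filter limit, to which [filterlim_Series] applies. *)
Lemma is_derive_quotient (f : R -> R) (t l : R) :
  is_derive f t l <->
  filterlim (fun h => (f (t + h) - f t) / h) (locally' 0) (locally l).
Proof.
  rewrite is_derive_Reals. split; intros H.
  - apply filterlim_locally; intros eps.
    destruct (H eps (cond_pos eps)) as [d Hd]. exists d. intros h Hh Hh0.
    apply (Hd h Hh0). change (Rabs (h - 0) < d) in Hh. now rewrite Rminus_0_r in Hh.
  - intros eps He.
    destruct (proj1 (filterlim_locally _ _) H (mkposreal _ He)) as [d Hd].
    exists d. intros h Hh0 Hh. apply (Hd h); [|exact Hh0].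
    change (Rabs (h - 0) < d). now rewrite Rminus_0_r.
Qed.

(** By the mean value theorem each difference quotient is a value of [g k], hence bounded by [M k];
    Tannery's theorem then passes to the limit. *)
Lemma is_derive_Series (f g : nat -> R -> R) (M : nat -> R) (t : R) (d : posreal) :
  (forall k s, Rabs (s - t) < d -> is_derive (f k) s (g k s)) ->
  (forall k s, Rabs (s - t) < d -> Rabs (g k s) <= M k) -> ex_series M ->
  (forall s, Rabs (s - t) < d -> ex_series (fun k => f k s)) ->
  is_derive (fun s => Series (fun k => f k s)) t (Series (fun k => g k t)).
Proof.
  intros Hd Hg HM Hf.
  assert (Ht : Rabs (t - t) < d)
    by (unfold Rminus; rewrite Rplus_opp_r, Rabs_R0; apply cond_pos).
  apply is_derive_quotient.
  apply (filterlim_ext_loc (fun h => Series (fun k => (f k (t + h) - f k t) / h))).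
  { exists d. intros h Hh Hh0. change (Rabs (h - 0) < d) in Hh.
    rewrite <- Series_minus.
    - symmetry. unfold Rdiv. rewrite Rmult_comm, <- Series_scal_l.
      apply Series_ext; intros k. apply Rmult_comm.
    - apply Hf. replace (t + h - t) with (h - 0) by ring. exact Hh.
    - now apply Hf. }
  apply (filterlim_Series _ (fun k h => (f k (t + h) - f k t) / h) (fun k => g k t) M).
  - intros k. apply is_derive_quotient. now apply Hd.
  - exists d. intros h Hh Hh0 k. change (Rabs (h - 0) < d) in Hh.
    rewrite Rminus_0_r in Hh.
    destruct (MVT_gen (f k) t (t + h) (g k)) as [c [Hc1 Hc2]].
    + intros s Hs. apply Hd. apply Rabs_lt_between in Hh. apply Rabs_lt_between.
      revert Hs. unfold Rmin, Rmax. destruct (Rle_dec t (t + h)); lra.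
    + intros s Hs. apply derivable_continuous_pt. exists (g k s).
      apply is_derive_Reals, Hd. apply Rabs_lt_between in Hh. apply Rabs_lt_between.
      revert Hs. unfold Rmin, Rmax. destruct (Rle_dec t (t + h)); lra.
    + rewrite Hc2. replace (g k c * (t + h - t) / h) with (g k c) by (field; exact Hh0).
      apply Hg. apply Rabs_lt_between in Hh. apply Rabs_lt_between.
      revert Hc1. unfold Rmin, Rmax. destruct (Rle_dec t (t + h)); lra.
  - intros k. now apply Hg.
  - exact HM.
Qed.

(** * Complex series *)

Lemma im_le_Cmod (z : C) : Rabs (Im z) <= Cmod z.
Proof. eapply Rle_trans; [apply Rmax_r|apply Rmax_Cmod]. Qed.

(** Componentwise, so that the real lemmas carry over, and so that [Li2_series z] is
    [Cseries (Li2_term z)] by conversion. *)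
Definition is_Cseries (a : nat -> C) (l : C) : Prop :=
  is_series (fun k => Re (a k)) (Re l) /\ is_series (fun k => Im (a k)) (Im l).

Definition Cseries (a : nat -> C) : C :=
  (Series (fun k => Re (a k)), Series (fun k => Im (a k))).

Lemma is_Cseries_unique (a : nat -> C) (l : C) : is_Cseries a l -> Cseries a = l.
Proof.
  intros [H1 H2]. destruct l as [x y]. unfold Cseries.
  f_equal; now apply is_series_unique.
Qed.

Lemma is_Cseries_is_series (a : nat -> C) (l : C) :
  is_Cseries a l -> is_series (V := C_NormedModule) a l.
Proof.
  intros [H1 H2]. unfold is_series in *. apply filterlim_locally; intros eps.
  pose proof (proj1 (filterlim_locally _ _) H1 eps) as H1'.
  pose proof (proj1 (filterlim_locally _ _) H2 eps) as H2'.
  generalize (filter_and _ _ H1' H2'). apply filter_imp. intros n [Ha Hb].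
  assert (Hs : forall m, sum_n (G := C_NormedModule) a m =
    (sum_n (fun k => Re (a k)) m, sum_n (fun k => Im (a k)) m)).
  { induction m as [|m IH]; [rewrite !sum_O; now destruct (a 0%nat)|].
    rewrite !sum_Sn, IH. now destruct (a (S m)). }
  rewrite Hs. split; assumption.
Qed.

Lemma Cseries_correct (a : nat -> C) (M : nat -> R) :
  (forall k, Cmod (a k) <= M k) -> ex_series M -> is_Cseries a (Cseries a).
Proof.
  intros H HM. split; apply Series_correct, ex_series_dominated with M; try assumption;
    intros k; (eapply Rle_trans; [|apply H]); [apply re_le_Cmod|apply im_le_Cmod].
Qed.

Lemma is_Cseries_ext (a b : nat -> C) (l : C) :
  (forall k, a k = b k) -> is_Cseries a l -> is_Cseries b l.
Proof.
  intros H [H1 H2]. split; [revert H1|revert H2]; apply is_series_ext;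
    intros k; now rewrite H.
Qed.

Lemma Cseries_ext (a b : nat -> C) : (forall k, a k = b k) -> Cseries a = Cseries b.
Proof.
  intros H. unfold Cseries. f_equal; apply Series_ext; intros k; now rewrite H.
Qed.

Lemma is_Cseries_plus (a b : nat -> C) (l m : C) :
  is_Cseries a l -> is_Cseries b m -> is_Cseries (fun k => Cplus (a k) (b k)) (Cplus l m).
Proof.
  intros [H1 H2] [H3 H4].
  split; apply (is_series_plus (V := R_NormedModule)); assumption.
Qed.

Lemma is_Cseries_mult_l (c : C) (a : nat -> C) (l : C) :
  is_Cseries a l -> is_Cseries (fun k => Cmult c (a k)) (Cmult c l).
Proof.
  intros [H1 H2]. split.
  - apply (is_series_minus (V := R_NormedModule));
      apply (is_series_scal_l (V := R_NormedModule)); assumption.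
  - apply (is_series_plus (V := R_NormedModule));
      apply (is_series_scal_l (V := R_NormedModule)); assumption.
Qed.

Lemma is_Cseries_incr_1 (a : nat -> C) (l : C) :
  is_Cseries a l -> is_Cseries (fun k => a (S k)) (Cminus l (a 0%nat)).
Proof.
  intros [H1 H2]. split.
  - apply (is_series_incr_1 (V := R_NormedModule) (fun k => Re (a k))).
    match goal with |- is_series _ ?x => replace x with (Re l) end; [exact H1|].
    change (Re l = Re l + - Re (a 0%nat) + Re (a 0%nat)). ring.
  - apply (is_series_incr_1 (V := R_NormedModule) (fun k => Im (a k))).
    match goal with |- is_series _ ?x => replace x with (Im l) end; [exact H2|].
    change (Im l = Im l + - Im (a 0%nat) + Im (a 0%nat)). ring.
Qed.

Lemma is_Cseries_decr_1 (a : nat -> C) (l : C) :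
  is_Cseries (fun k => a (S k)) (Cminus l (a 0%nat)) -> is_Cseries a l.
Proof.
  intros [H1 H2]. split; apply (is_series_decr_1 (V := R_NormedModule));
    [exact H1|exact H2].
Qed.

Lemma ex_series_Cmod (a : nat -> C) : ex_series (fun k => Cmod (a k)) ->
  ex_series (fun k => Rabs (Re (a k))) /\ ex_series (fun k => Rabs (Im (a k))).
Proof.
  intros H. split; (apply ex_series_dominated with (2 := H)); intros k;
    rewrite Rabs_Rabsolu; [apply re_le_Cmod|apply im_le_Cmod].
Qed.

Lemma Re_RtoC_mult (x : R) (z : C) : Re (Cmult (RtoC x) z) = x * Re z.
Proof. unfold Re; simpl; ring. Qed.

Lemma Im_RtoC_mult (x : R) (z : C) : Im (Cmult (RtoC x) z) = x * Im z.
Proof. unfold Im; simpl; ring. Qed.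

(** Four real Cauchy products of real and imaginary parts, recombined through
    [w ^ n = w ^ k * w ^ (n - k)]. *)
Lemma is_Cseries_power_mult (a b : nat -> R) (w la lb : C) :
  ex_series (fun k => Rabs (a k) * Cmod w ^ k) ->
  ex_series (fun k => Rabs (b k) * Cmod w ^ k) ->
  is_Cseries (fun k => Cmult (RtoC (a k)) (Cpow w k)) la ->
  is_Cseries (fun k => Cmult (RtoC (b k)) (Cpow w k)) lb ->
  is_Cseries (fun n => Cmult (RtoC (sum_f_R0 (fun k => a k * b (n - k)%nat) n)) (Cpow w n))
    (Cmult la lb).
Proof.
  assert (Hc : forall a, ex_series (fun k => Rabs (a k) * Cmod w ^ k) ->
    ex_series (fun k => Cmod (Cmult (RtoC (a k)) (Cpow w k)))).
  { intros c. apply ex_series_ext; intros k. now rewrite Cmod_mult, Cmod_pow, Cmod_R. }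
  intros Ha%Hc%ex_series_Cmod Hb%Hc%ex_series_Cmod [A1 A2] [B1 B2].
  destruct Ha as [Ha1 Ha2], Hb as [Hb1 Hb2].
  pose proof (is_series_mult _ _ _ _ A1 B1 Ha1 Hb1) as P1.
  pose proof (is_series_mult _ _ _ _ A2 B2 Ha2 Hb2) as P2.
  pose proof (is_series_mult _ _ _ _ A1 B2 Ha1 Hb2) as P3.
  pose proof (is_series_mult _ _ _ _ A2 B1 Ha2 Hb1) as P4.
  assert (Hp : forall n k, (k <= n)%nat -> Cpow w n = Cmult (Cpow w k) (Cpow w (n - k))).
  { intros n k Hk. rewrite <- Cpow_add_r. f_equal; lia. }
  split.
  - pose proof (is_series_minus (V := R_NormedModule) _ _ _ _ P1 P2) as P.
    revert P. apply is_series_ext; intros n.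
    rewrite Re_RtoC_mult, Rmult_comm, scal_sum.
    match goal with |- plus ?x (opp ?y) = _ => change (plus x (opp y)) with (x - y) end.
    rewrite <- minus_sum.
    apply sum_eq; intros k Hk. rewrite !Re_RtoC_mult, !Im_RtoC_mult, (Hp n k Hk).
    unfold Re, Im; simpl; ring.
  - pose proof (is_series_plus (V := R_NormedModule) _ _ _ _ P3 P4) as P.
    revert P. apply is_series_ext; intros n.
    rewrite Im_RtoC_mult, Rmult_comm, scal_sum.
    match goal with |- plus ?x ?y = _ => change (plus x y) with (x + y) end.
    rewrite <- sum_plus.
    apply sum_eq; intros k Hk. rewrite !Re_RtoC_mult, !Im_RtoC_mult, (Hp n k Hk).
    unfold Re, Im; simpl; ring.
Qed.

Lemma is_series_even (a : nat -> R) (l : R) :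
  (forall k, a (S (2 * k)) = 0) -> is_series a l -> is_series (fun k => a (2 * k)%nat) l.
Proof.
  intros Ha H.
  assert (Hs : forall N, sum_n (fun k => a (2 * k)%nat) N = sum_n a (2 * N)).
  { induction N as [|N IH]; [now rewrite !sum_O|].
    replace (2 * S N)%nat with (S (S (2 * N))) by lia.
    rewrite !sum_Sn, IH, Ha.
    match goal with |- context [plus ?x 0] =>
      replace (plus x 0) with x by (symmetry; apply Rplus_0_r) end.
    do 2 f_equal. lia. }
  apply (filterlim_ext (fun N => sum_n a (2 * N))); [intros N; symmetry; apply Hs|].
  apply filterlim_comp with (2 := H). intros P [N HN].
  exists N. intros n Hn. apply HN. lia.
Qed.

Lemma is_Cseries_even (a : nat -> C) (l : C) :
  (forall k, a (S (2 * k)) = RtoC 0) -> is_Cseries a l ->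
  is_Cseries (fun k => a (2 * k)%nat) l.
Proof.
  intros Ha [H1 H2]. split.
  - apply (is_series_even (fun k => Re (a k))); [intros k; now rewrite Ha|exact H1].
  - apply (is_series_even (fun k => Im (a k))); [intros k; now rewrite Ha|exact H2].
Qed.

(** * Complex derivatives *)

(* The limit is taken along every line through [w] only. *)
Definition is_Cderive (F : C -> C) (w l : C) : Prop :=
  forall d : C,
    is_derive (fun s => Re (F (w + RtoC s * d)%C)) 0 (Re (l * d)%C) /\
    is_derive (fun s => Im (F (w + RtoC s * d)%C)) 0 (Im (l * d)%C).

Lemma is_derive_shift (f : R -> R) (t l : R) :
  is_derive (fun s => f (t + s)) 0 l -> is_derive f t l.
Proof.
  intros H. apply (is_derive_ext (fun s => f (t + (s - t)))); [intros s; f_equal; ring|].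
  assert (Hl : is_derive (fun s : R => s - t) t 1) by (auto_derive; [trivial|ring]).
  rewrite <- (Rmult_1_l l).
  apply (is_derive_comp (V := R_NormedModule) (fun s => f (t + s)) (fun s => s - t));
    [|exact Hl].
  replace (t - t) with 0 by ring. exact H.
Qed.

Lemma is_Cderive_line (F : C -> C) (w d l : C) (t : R) :
  is_Cderive F (w + RtoC t * d)%C l ->
  is_derive (fun s => Re (F (w + RtoC s * d)%C)) t (Re (l * d)%C) /\
  is_derive (fun s => Im (F (w + RtoC s * d)%C)) t (Im (l * d)%C).
Proof.
  intros H. destruct (H d) as [H1 H2].
  split; apply is_derive_shift; [revert H1|revert H2]; apply is_derive_ext; intros s;
    do 2 f_equal; rewrite RtoC_plus; ring.
Qed.

Lemma is_Cderive_ext (F G : C -> C) (w l : C) :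
  (forall u, F u = G u) -> is_Cderive F w l -> is_Cderive G w l.
Proof.
  intros H HF d. destruct (HF d) as [H1 H2].
  split; [revert H1|revert H2]; apply is_derive_ext; intros s; now rewrite H.
Qed.

Lemma is_Cderive_const (c w : C) : is_Cderive (fun _ => c) w (RtoC 0).
Proof.
  intros d. rewrite Cmult_0_l. split; apply is_derive_Rconst.
Qed.

Lemma is_Cderive_id (w : C) : is_Cderive (fun u => u) w (RtoC 1).
Proof.
  intros d. rewrite Cmult_1_l. destruct w, d. unfold Re, Im; simpl.
  split; auto_derive; try trivial; ring.
Qed.

Lemma is_Cderive_plus (F G : C -> C) (w l m : C) :
  is_Cderive F w l -> is_Cderive G w m ->
  is_Cderive (fun u => F u + G u)%C w (l + m)%C.
Proof.
  intros HF HG d. destruct (HF d) as [F1 F2], (HG d) as [G1 G2].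
  rewrite Cmult_plus_distr_r. split; now apply is_derive_Rplus.
Qed.

Lemma is_Cderive_mult (F G : C -> C) (w l m : C) :
  is_Cderive F w l -> is_Cderive G w m ->
  is_Cderive (fun u => F u * G u)%C w (l * G w + F w * m)%C.
Proof.
  intros HF HG d. destruct (HF d) as [F1 F2], (HG d) as [G1 G2].
  assert (H0 : (w + RtoC 0 * d)%C = w) by ring.
  split.
  - pose proof (is_derive_Rminus _ _ _ _ _ (is_derive_Rmult _ _ _ _ _ F1 G1)
      (is_derive_Rmult _ _ _ _ _ F2 G2)) as H.
    cbv beta in H. rewrite H0 in H.
    replace (Re ((l * G w + F w * m) * d)) with
      (Re (l * d) * Re (G w) + Re (F w) * Re (m * d) -
       (Im (l * d) * Im (G w) + Im (F w) * Im (m * d)))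
      by (unfold Re, Im; simpl; ring).
    exact H.
  - pose proof (is_derive_Rplus _ _ _ _ _ (is_derive_Rmult _ _ _ _ _ F1 G2)
      (is_derive_Rmult _ _ _ _ _ F2 G1)) as H.
    cbv beta in H. rewrite H0 in H.
    replace (Im ((l * G w + F w * m) * d)) with
      (Re (l * d) * Im (G w) + Re (F w) * Im (m * d) +
       (Im (l * d) * Re (G w) + Im (F w) * Re (m * d)))
      by (unfold Re, Im; simpl; ring).
    exact H.
Qed.

Lemma is_Cderive_mult_l (c : C) (F : C -> C) (w l : C) :
  is_Cderive F w l -> is_Cderive (fun u => c * F u)%C w (c * l)%C.
Proof.
  intros HF. pose proof (is_Cderive_mult _ _ _ _ _ (is_Cderive_const c w) HF) as H.
  rewrite Cmult_0_l, Cplus_0_l in H. exact H.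
Qed.

Lemma is_Cderive_minus (F G : C -> C) (w l m : C) :
  is_Cderive F w l -> is_Cderive G w m ->
  is_Cderive (fun u => F u - G u)%C w (l - m)%C.
Proof.
  intros HF HG.
  replace (l - m)%C with (l + RtoC (-1) * m)%C by (ring).
  apply (is_Cderive_ext (fun u => F u + RtoC (-1) * G u)%C);
    [intros u; ring|].
  now apply is_Cderive_plus, is_Cderive_mult_l.
Qed.

Lemma is_Cderive_pow (F : C -> C) (n : nat) (w l : C) :
  is_Cderive F w l ->
  is_Cderive (fun u => Cpow (F u) n) w (RtoC (INR n) * Cpow (F w) (pred n) * l)%C.
Proof.
  intros HF. induction n as [|n IH].
  - simpl Cpow. replace (RtoC (INR 0) * 1 * l)%C with (RtoC 0) by (simpl INR; ring).
    apply is_Cderive_const.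
  - replace (RtoC (INR (S n)) * Cpow (F w) (pred (S n)) * l)%C with
      (l * Cpow (F w) n + F w * (RtoC (INR n) * Cpow (F w) (pred n) * l))%C.
    + exact (is_Cderive_mult _ _ _ _ _ HF IH).
    + rewrite S_INR, RtoC_plus. destruct n as [|n]; simpl pred; [simpl; ring|].
      rewrite (Cpow_S _ n). ring.
Qed.

Definition Cexp (w : C) : C := (exp (Re w) * cos (Im w), exp (Re w) * sin (Im w)).

Lemma is_Cderive_Cexp (w : C) : is_Cderive Cexp w (Cexp w).
Proof.
  intros [d1 d2]. destruct w as [a b]. unfold Cexp, Re, Im; simpl.
  split; auto_derive; try trivial;
    replace (a + (0 * d1 - 0 * d2)) with a by ring;
    replace (b + (0 * d2 + 0 * d1)) with b by ring;
    replace (a + (0 * d1 + - (0 * d2))) with a by ring; ring.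
Qed.

(** Only the restriction of [F] to a segment matters, which is why derivatives along lines suffice
    throughout. *)
Lemma is_Cderive_zero_const (F : C -> C) (w1 w2 : C) :
  (forall t, 0 <= t <= 1 -> is_Cderive F (w1 + RtoC t * (w2 - w1))%C (RtoC 0)) ->
  F w1 = F w2.
Proof.
  intros H.
  assert (Hc : forall f : R -> R, (forall t, 0 <= t <= 1 -> is_derive f t 0) -> f 0 = f 1).
  { intros f Hf. apply Rle_antisym.
    - apply (is_derive_le f (fun _ => 0)); [lra|exact Hf|intros; lra].
    - apply Ropp_le_cancel.
      apply (is_derive_le (fun t => - f t) (fun _ => 0)); [lra| |intros; lra].
      intros t Ht. rewrite <- Ropp_0.
      apply (is_derive_opp (K := R_AbsRing) (V := R_NormedModule)). now apply Hf. }
  assert (E0 : (w1 + RtoC 0 * (w2 - w1))%C = w1) by ring.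
  assert (E1 : (w1 + RtoC 1 * (w2 - w1))%C = w2) by ring.
  assert (HR : Re (F w1) = Re (F w2)).
  { rewrite <- E0 at 1. rewrite <- E1 at 2.
    apply (Hc (fun s => Re (F (w1 + RtoC s * (w2 - w1))%C))). intros t Ht.
    pose proof (proj1 (is_Cderive_line _ _ _ _ _ (H t Ht))) as H1.
    now rewrite Cmult_0_l in H1. }
  assert (HI : Im (F w1) = Im (F w2)).
  { rewrite <- E0 at 1. rewrite <- E1 at 2.
    apply (Hc (fun s => Im (F (w1 + RtoC s * (w2 - w1))%C))). intros t Ht.
    pose proof (proj2 (is_Cderive_line _ _ _ _ _ (H t Ht))) as H1.
    now rewrite Cmult_0_l in H1. }
  unfold Re, Im in *. destruct (F w1), (F w2). simpl in *. congruence.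
Qed.

Lemma is_Cderive_Cseries (F G : nat -> C -> C) (M : nat -> R) (w : C) (eps : R) :
  0 < eps ->
  (forall k u, Cmod (u - w) < eps -> is_Cderive (F k) u (G k u)) ->
  (forall k u, Cmod (u - w) < eps -> Cmod (F k u) <= M k /\ Cmod (G k u) <= M k) ->
  ex_series M ->
  is_Cderive (fun u => Cseries (fun k => F k u)) w (Cseries (fun k => G k w)).
Proof.
  intros Heps Hd Hb HM d.
  assert (Hd0 : 0 < Cmod d + 1) by (pose proof (Cmod_ge_0 d); lra).
  (* Parameters this small keep [w + s d] in the disc where the bounds hold; the [+ 1] covers
     [d = 0]. *)
  assert (He : 0 < eps / (Cmod d + 1)) by now apply Rdiv_lt_0_compat.
  set (delta := mkposreal _ He).
  assert (Hin : forall s, Rabs (s - 0) < delta -> Cmod (w + RtoC s * d - w)%C < eps).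
  { intros s Hs. simpl in Hs. rewrite Rminus_0_r in Hs.
    replace (w + RtoC s * d - w)%C with (RtoC s * d)%C by ring.
    rewrite Cmod_mult, Cmod_R. apply Rlt_div_r in Hs; [|assumption].
    pose proof (Rabs_pos s). nra. }
  assert (HM' : ex_series (fun k => M k * Cmod d)) by now apply ex_series_scal_r.
  assert (E0 : (w + RtoC 0 * d)%C = w) by ring.
  assert (HS : is_Cseries (fun k => d * G k w)%C (d * Cseries (fun k => G k w))%C).
  { apply is_Cseries_mult_l, Cseries_correct with M; [|assumption]. intros k. apply Hb.
    replace (w - w)%C with (RtoC 0) by ring. now rewrite Cmod_0. }
  destruct HS as [HS1 HS2]. rewrite Cmult_comm.
  split.
  - rewrite <- (is_series_unique _ _ HS1).
    pose proof (is_derive_Series (fun k s => Re (F k (w + RtoC s * d)%C))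
      (fun k s => Re (d * G k (w + RtoC s * d))%C) (fun k => M k * Cmod d) 0 delta) as H.
    cbv beta in H. rewrite E0 in H. apply H; [| |exact HM'|].
    + intros k s Hs. rewrite Cmult_comm. apply is_Cderive_line, Hd, Hin, Hs.
    + intros k s Hs. eapply Rle_trans; [apply re_le_Cmod|].
      rewrite Cmod_mult, Rmult_comm. apply Rmult_le_compat_r; [apply Cmod_ge_0|].
      apply Hb, Hin, Hs.
    + intros s Hs. apply ex_series_dominated with M; [|exact HM]. intros k.
      eapply Rle_trans; [apply re_le_Cmod|]. apply Hb, Hin, Hs.
  - rewrite <- (is_series_unique _ _ HS2).
    pose proof (is_derive_Series (fun k s => Im (F k (w + RtoC s * d)%C))
      (fun k s => Im (d * G k (w + RtoC s * d))%C) (fun k => M k * Cmod d) 0 delta) as H.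
    cbv beta in H. rewrite E0 in H. apply H; [| |exact HM'|].
    + intros k s Hs. rewrite Cmult_comm. apply is_Cderive_line, Hd, Hin, Hs.
    + intros k s Hs. eapply Rle_trans; [apply im_le_Cmod|].
      rewrite Cmod_mult, Rmult_comm. apply Rmult_le_compat_r; [apply Cmod_ge_0|].
      apply Hb, Hin, Hs.
    + intros s Hs. apply ex_series_dominated with M; [|exact HM]. intros k.
      eapply Rle_trans; [apply im_le_Cmod|]. apply Hb, Hin, Hs.
Qed.

(** * The exponential *)

Lemma ex_series_exp (r : R) : ex_series (fun n => / INR (fact n) * r ^ n).
Proof.
  exists (exp r). pose proof (is_exp_Reals r) as H. apply is_pseries_R in H. exact H.
Qed.

Lemma ex_series_Rplus (a b : nat -> R) :
  ex_series a -> ex_series b -> ex_series (fun n => a n + b n).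
Proof. exact (ex_series_plus (V := R_NormedModule) a b). Qed.

Lemma ex_series_Rscal (c : R) (a : nat -> R) : ex_series a -> ex_series (fun n => c * a n).
Proof. exact (ex_series_scal_l c a). Qed.

Lemma ex_series_shift (a : nat -> R) : ex_series (fun n => a (S n)) -> ex_series a.
Proof. exact (proj2 (ex_series_incr_1 (V := R_NormedModule) a)). Qed.

Lemma is_Cseries_0 : is_Cseries (fun _ => RtoC 0) (RtoC 0).
Proof.
  assert (H : ex_series (fun _ : nat => 0)).
  { apply ex_series_dominated with (fun n => 0 * (/ 2) ^ n).
    - intros k. rewrite Rabs_R0; lra.
    - apply ex_series_Rscal, ex_series_geom. rewrite Rabs_pos_eq; lra. }
  assert (H0 : forall k : nat, Cmod (RtoC 0) <= 0) by (intros _; rewrite Cmod_0; lra).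
  pose proof (is_Cseries_mult_l (RtoC 0) _ _ (Cseries_correct (fun _ => RtoC 0) _ H0 H)) as H1.
  rewrite Cmult_0_l in H1. revert H1. apply is_Cseries_ext; intros k; ring.
Qed.

Lemma is_Cseries_delta (m : nat) (w : C) :
  is_Cseries (fun n => RtoC (delta m n) * Cpow w n)%C (Cpow w m).
Proof.
  induction m as [|m IH]; apply is_Cseries_decr_1; unfold delta; cbn [Nat.eqb Cpow].
  - replace (RtoC 1 - RtoC 1 * RtoC 1)%C with (RtoC 0) by ring.
    generalize is_Cseries_0. apply is_Cseries_ext; intros k; ring.
  - replace (w * Cpow w m - RtoC 0 * RtoC 1)%C with (w * Cpow w m)%C by ring.
    generalize (is_Cseries_mult_l w _ _ IH). apply is_Cseries_ext; intros k.
    unfold delta. ring.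
Qed.

Lemma Cmod_coef_pow (c : R) (u : C) (n : nat) :
  Cmod (RtoC c * Cpow u n)%C = Rabs c * Cmod u ^ n.
Proof. now rewrite Cmod_mult, Cmod_pow, Cmod_R. Qed.

Lemma Cmod_near (u w : C) (e : R) : Cmod (u - w)%C < e -> Cmod u < Cmod w + e.
Proof.
  intros H. pose proof (Cmod_triangle (u - w)%C w) as H1.
  replace (u - w + w)%C with u in H1 by ring. lra.
Qed.

Lemma Cmod_coef_pow_le (c : R) (u : C) (n : nat) (r : R) : Cmod u <= r ->
  Cmod (RtoC c * Cpow u n)%C <= Rabs c * r ^ n.
Proof.
  intros H. rewrite Cmod_coef_pow. apply Rmult_le_compat_l; [apply Rabs_pos|].
  apply pow_incr. split; [apply Cmod_ge_0|assumption].
Qed.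

Lemma is_Cderive_coef_pow (c : R) (n : nat) (w : C) :
  is_Cderive (fun u => RtoC c * Cpow u n)%C w (RtoC (c * INR n) * Cpow w (pred n))%C.
Proof.
  replace (RtoC (c * INR n) * Cpow w (pred n))%C with
    (RtoC c * (RtoC (INR n) * Cpow w (pred n) * RtoC 1))%C by (rewrite RtoC_mult; ring).
  apply is_Cderive_mult_l, (is_Cderive_pow (fun u => u)), is_Cderive_id.
Qed.

(** The exponents [e n] are left free because [bern_sum] uses [S n], and [bern_sum'] and the
    exponential use [n]. *)
Lemma is_Cderive_power_series (c : nat -> R) (e : nat -> nat) (w : C) (r : R) :
  Cmod w < r ->
  ex_series (fun n => Rabs (c n) * r ^ e n) ->
  ex_series (fun n => Rabs (c n * INR (e n)) * r ^ pred (e n)) ->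
  is_Cderive (fun u => Cseries (fun n => RtoC (c n) * Cpow u (e n))%C) w
    (Cseries (fun n => RtoC (c n * INR (e n)) * Cpow w (pred (e n)))%C).
Proof.
  intros Hr H1 H2.
  pose proof (ex_series_Rplus _ _ H1 H2) as HM.
  apply (is_Cderive_Cseries (fun n u => RtoC (c n) * Cpow u (e n))%C
    (fun n u => RtoC (c n * INR (e n)) * Cpow u (pred (e n)))%C _ w (r - Cmod w))
    with (4 := HM); [lra| |].
  - intros k u _. apply is_Cderive_coef_pow.
  - intros k u Hu. apply Cmod_near in Hu.
    assert (Hu' : Cmod u <= r) by lra. pose proof (Cmod_ge_0 u).
    pose proof (Cmod_coef_pow_le (c k) u (e k) r Hu') as B1.
    pose proof (Cmod_coef_pow_le (c k * INR (e k)) u (pred (e k)) r Hu') as B2.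
    pose proof (Cmod_ge_0 (RtoC (c k) * Cpow u (e k))%C).
    pose proof (Cmod_ge_0 (RtoC (c k * INR (e k)) * Cpow u (pred (e k)))%C).
    lra.
Qed.

Lemma fact_S_inv (n : nat) : / INR (fact (S n)) * INR (S n) = / INR (fact n).
Proof.
  rewrite fact_simpl, mult_INR. field.
  split; [apply INR_fact_neq_0|apply not_0_INR; lia].
Qed.

Lemma inv_fact_pos (n : nat) : 0 < / INR (fact n).
Proof. apply Rinv_0_lt_compat, INR_fact_lt_0. Qed.

(** The sum [F] satisfies [F' = F] and [F 0 = 1], so [F u * Cexp (- u)] has derivative zero and
    equals [1]. *)
Lemma is_Cseries_exp (w : C) :
  is_Cseries (fun n => RtoC (/ INR (fact n)) * Cpow w n)%C (Cexp w).
Proof.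
  set (F := fun u => Cseries (fun n => RtoC (/ INR (fact n)) * Cpow u n)%C).
  assert (Habs : forall r, ex_series (fun n => Rabs (/ INR (fact n)) * r ^ n)).
  { intros r. generalize (ex_series_exp r). apply ex_series_ext; intros n.
    now rewrite Rabs_pos_eq by (left; apply inv_fact_pos). }
  assert (HF : forall u, is_Cseries (fun n => RtoC (/ INR (fact n)) * Cpow u n)%C (F u)).
  { intros u. apply Cseries_correct with (2 := Habs (Cmod u)).
    intros k. rewrite Cmod_coef_pow. lra. }
  assert (HdF : forall u, is_Cderive F u (F u)).
  { intros u.
    replace (F u) with (Cseries (fun n => RtoC (/ INR (fact n) * INR n) * Cpow u (pred n))%C).
    - apply (is_Cderive_power_series (fun n => / INR (fact n)) (fun n => n) u (Cmod u + 1));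
        [lra|apply Habs|].
      apply ex_series_shift. generalize (Habs (Cmod u + 1)).
      apply ex_series_ext; intros n. now rewrite fact_S_inv.
    - apply is_Cseries_unique, is_Cseries_decr_1. simpl (INR 0).
      rewrite Rmult_0_r, Cmult_0_l. replace (F u - RtoC 0)%C with (F u) by ring.
      generalize (HF u). apply is_Cseries_ext; intros n. now rewrite fact_S_inv. }
  assert (HE : forall u, is_Cderive (fun v => Cexp (- v)%C) u (- Cexp (- u))%C).
  { intros [a b] [d1 d2]. unfold Cexp, Re, Im; simpl.
    split; auto_derive; try trivial;
      replace (- (a + (0 * d1 - 0 * d2))) with (- a) by ring;
      replace (- (b + (0 * d2 + 0 * d1))) with (- b) by ring;
      replace (- (a + (0 * d1 + - (0 * d2)))) with (- a) by ring; ring. }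
  assert (HC : forall u, (Cexp (- u) * Cexp u = RtoC 1)%C).
  { intros [a b]. unfold Cexp, Re, Im, Cmult, RtoC; simpl.
    rewrite cos_neg, sin_neg. pose proof (sin2_cos2 b) as H. unfold Rsqr in H.
    assert (He : exp (- a) * exp a = 1) by (rewrite <- exp_plus, Rplus_opp_l; apply exp_0).
    f_equal; [|ring].
    transitivity (exp (- a) * exp a * (sin b * sin b + cos b * cos b)); [ring|].
    rewrite H, He; ring. }
  assert (Hconst : (F (RtoC 0) * Cexp (- RtoC 0) = F w * Cexp (- w))%C).
  { apply (is_Cderive_zero_const (fun u => F u * Cexp (- u))%C). intros t _.
    set (u := (_ + _)%C).
    replace (RtoC 0) with (F u * Cexp (- u) + F u * - Cexp (- u))%C by ring.
    exact (is_Cderive_mult _ _ _ _ _ (HdF u) (HE u)). }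
  assert (H0 : F (RtoC 0) = RtoC 1).
  { apply is_Cseries_unique, is_Cseries_decr_1. simpl fact. simpl INR.
    rewrite Rinv_1. cbn [Cpow]. replace (RtoC 1 - RtoC 1 * RtoC 1)%C with (RtoC 0) by ring.
    generalize is_Cseries_0. apply is_Cseries_ext; intros k; ring. }
  assert (H1 : Cexp (- RtoC 0)%C = RtoC 1).
  { unfold Cexp, RtoC, Re, Im; simpl. rewrite Ropp_0, exp_0, cos_0, sin_0. f_equal; ring. }
  rewrite H0, H1 in Hconst.
  replace (Cexp w) with (F w); [apply HF|].
  transitivity (F w * (Cexp (- w) * Cexp w))%C; [rewrite HC; ring|].
  rewrite Cmult_assoc, <- Hconst. ring.
Qed.

Lemma Cmod_Cexp (w : C) : Cmod (Cexp w) = exp (Re w).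
Proof.
  unfold Cmod, Cexp; simpl.
  replace (_ + _) with (exp (Re w) ^ 2 * ((sin (Im w))² + (cos (Im w))²))
    by (unfold Rsqr; ring).
  rewrite sin2_cos2, Rmult_1_r. apply sqrt_pow2. left; apply exp_pos.
Qed.

(** * The generating function *)

Lemma ex_series_coth_pow (r : R) : 0 <= r < 2 * PI ->
  ex_series (fun n => Rabs (coth_coef n) * r ^ n).
Proof.
  intros Hr. generalize (ex_series_cot_coef r Hr). apply ex_series_ext; intros n.
  now rewrite Rabs_coth_coef.
Qed.

Lemma ex_series_coth_pow_pred (r : R) : 0 <= r < 2 * PI ->
  ex_series (fun n => Rabs (coth_coef n) * r ^ pred n).
Proof.
  intros Hr. set (s := (r + 2 * PI) / 2).
  assert (Hs : 0 < s /\ r <= s /\ s < 2 * PI) by (unfold s; lra).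
  apply ex_series_dominated with (fun n => / s * (Rabs (coth_coef n) * s ^ n)).
  - intros n. rewrite Rabs_mult, Rabs_Rabsolu, (Rabs_pos_eq (r ^ pred n)) by (apply pow_le; lra).
    destruct n as [|n]; [rewrite coth_coef_0, Rabs_R0; lra|].
    simpl pred. replace (/ s * (Rabs (coth_coef (S n)) * s ^ S n)) with
      (Rabs (coth_coef (S n)) * s ^ n) by (simpl; field; lra).
    apply Rmult_le_compat_l; [apply Rabs_pos|]. apply pow_incr; lra.
  - apply ex_series_Rscal, ex_series_coth_pow; lra.
Qed.

(** The function [1 / (exp w - 1) + 1 / 2 - 1 / w], extended through its removable singularity at
    [0]. *)
Definition coth_quot (w : C) : C :=
  Cseries (fun n => RtoC (coth_coef n) * Cpow w (pred n))%C.

(** The Cauchy product [bern_coef_rec], now summed at complex [w], which the absolute convergence up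
    to [2 PI] permits. The form without denominators covers [w = 0] as well. *)
Lemma coth_quot_spec (w : C) : Cmod w < 2 * PI ->
  ((w * coth_quot w + RtoC 1 - w / RtoC 2) * (Cexp w - RtoC 1) = w)%C.
Proof.
  intros Hw. set (r := Cmod w) in *.
  assert (Hr : 0 <= r < 2 * PI) by (split; [apply Cmod_ge_0|exact Hw]).
  assert (HQ : is_Cseries (fun n => RtoC (coth_coef n) * Cpow w (pred n))%C (coth_quot w)).
  { apply Cseries_correct with (2 := ex_series_coth_pow_pred r Hr).
    intros k. rewrite Cmod_coef_pow. apply Rle_refl. }
  apply (is_Cseries_mult_l w) in HQ.
  assert (HB : is_Cseries (fun n => RtoC (bern_coef n) * Cpow w n)%C
    (w * coth_quot w + RtoC 1 - w / RtoC 2)%C).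
  { pose proof (is_Cseries_plus _ _ _ _ (is_Cseries_plus _ _ _ _ HQ (is_Cseries_delta 0 w))
      (is_Cseries_mult_l (RtoC (- / 2)) _ _ (is_Cseries_delta 1 w))) as H.
    replace (w * coth_quot w + RtoC 1 - w / RtoC 2)%C with
      (w * coth_quot w + Cpow w 0 + RtoC (- / 2) * Cpow w 1)%C.
    - revert H. apply is_Cseries_ext; intros n. unfold coth_coef.
      destruct n as [|n].
      + unfold delta; simpl. unfold bern_coef, Bernoulli; simpl.
        unfold Cmult, Cplus, RtoC; simpl. destruct w; simpl. f_equal; field.
      + simpl pred. rewrite Cpow_S.
        replace (delta 0 (S n)) with 0 by reflexivity.
        rewrite !RtoC_plus, RtoC_minus, RtoC_opp, RtoC_mult. ring.
    - rewrite Cpow_1_r. simpl Cpow. rewrite RtoC_opp, RtoC_inv by lra. unfold Cdiv. ring. }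
  set (E := Cseries (fun n => RtoC (exp1_coef n) * Cpow w n)%C).
  assert (HEabs : ex_series (fun n => Rabs (exp1_coef n) * r ^ n)).
  { apply ex_series_dominated with (2 := ex_series_exp r). intros n.
    rewrite Rabs_mult, Rabs_Rabsolu, (Rabs_pos_eq (r ^ n)) by (apply pow_le; lra).
    apply Rmult_le_compat_r; [apply pow_le; lra|].
    pose proof (exp1_coef_bound n). rewrite Rabs_pos_eq by lra.
    unfold exp1_coef. rewrite <- (fact_S_inv n).
    rewrite <- (Rmult_1_r (/ INR (fact (S n)))) at 1.
    apply Rmult_le_compat_l; [left; apply inv_fact_pos|].
    rewrite S_INR; pose proof (pos_INR n); lra. }
  assert (HE : is_Cseries (fun n => RtoC (exp1_coef n) * Cpow w n)%C E).
  { apply Cseries_correct with (2 := HEabs). intros k. rewrite Cmod_coef_pow. apply Rle_refl. }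
  assert (HwE : (w * E = Cexp w - RtoC 1)%C).
  { rewrite <- (is_Cseries_unique _ _ (is_Cseries_mult_l w _ _ HE)).
    apply is_Cseries_unique. pose proof (is_Cseries_incr_1 _ _ (is_Cseries_exp w)) as H.
    replace (Cexp w - RtoC 1)%C with (Cexp w - RtoC (/ INR (fact 0)) * Cpow w 0)%C
      by (simpl; rewrite Rinv_1; ring).
    revert H. apply is_Cseries_ext; intros n. unfold exp1_coef. rewrite Cpow_S. ring. }
  assert (HBabs : ex_series (fun n => Rabs (bern_coef n) * r ^ n)).
  { apply ex_series_dominated with (fun n => Rabs (coth_coef n) * r ^ n +
      (delta 0 n + / 2 * delta 1 n) * r ^ n).
    - intros n. rewrite Rabs_mult, Rabs_Rabsolu, (Rabs_pos_eq (r ^ n)) by (apply pow_le; lra).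
      rewrite <- Rmult_plus_distr_r. apply Rmult_le_compat_r; [apply pow_le; lra|].
      replace (bern_coef n) with (coth_coef n + (delta 0 n - / 2 * delta 1 n))
        by (unfold coth_coef; ring).
      eapply Rle_trans; [apply Rabs_triang|]. apply Rplus_le_compat_l.
      unfold delta. destruct (Nat.eqb n 0), (Nat.eqb n 1); apply Rabs_le; lra.
    - apply ex_series_Rplus; [now apply ex_series_coth_pow|].
      do 2 apply ex_series_shift.
      destruct is_Cseries_0 as [H _]. exists (Re (RtoC 0)). revert H.
      apply is_series_ext; intros n. unfold delta; simpl. ring. }
  pose proof (is_Cseries_power_mult _ _ w _ _ HBabs HEabs HB HE) as H.
  assert (H1 : ((w * coth_quot w + RtoC 1 - w / RtoC 2) * E = RtoC 1)%C).
  { rewrite <- (is_Cseries_unique _ _ H). apply is_Cseries_unique.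
    generalize (is_Cseries_delta 0 w). apply is_Cseries_ext; intros n.
    now rewrite bern_coef_rec. }
  rewrite <- HwE.
  transitivity (w * ((w * coth_quot w + RtoC 1 - w / RtoC 2) * E))%C; [ring|].
  rewrite H1; ring.
Qed.

(** * The Bernoulli series *)

(** Two integrations of [2 * coth_quot]. At [n = 2 k] this is [Bernoulli (2 k) / (k (2 k + 1)!)]; at
    [n = 0] the numerator is zero. *)
Definition bern_sum_coef (n : nat) : R := 2 * coth_coef n / (INR n * INR (S n)).

Definition bern_sum (w : C) : C :=
  Cseries (fun n => RtoC (bern_sum_coef n) * Cpow w (S n))%C.

Definition bern_sum' (w : C) : C :=
  Cseries (fun n => RtoC (bern_sum_coef n * INR (S n)) * Cpow w n)%C.

Lemma bern_sum_coef_mult (n : nat) :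
  bern_sum_coef n * INR (S n) * INR n = 2 * coth_coef n.
Proof.
  destruct n as [|n]; [rewrite coth_coef_0; simpl; ring|].
  unfold bern_sum_coef. field. split; apply not_0_INR; lia.
Qed.

Lemma Rabs_le_mult_S (x : R) (n : nat) : Rabs x <= Rabs (x * INR (S n)).
Proof.
  rewrite Rabs_mult, <- (Rmult_1_r (Rabs x)) at 1.
  apply Rmult_le_compat_l; [apply Rabs_pos|].
  rewrite S_INR. pose proof (pos_INR n). rewrite Rabs_pos_eq; lra.
Qed.

Lemma bern_sum'_coef_bound (n : nat) :
  Rabs (bern_sum_coef n * INR (S n)) <= 2 * Rabs (coth_coef n).
Proof.
  replace (2 * Rabs (coth_coef n)) with (Rabs (2 * coth_coef n))
    by (rewrite Rabs_mult, (Rabs_pos_eq 2); lra).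
  rewrite <- bern_sum_coef_mult. destruct n as [|n]; [|apply Rabs_le_mult_S].
  unfold bern_sum_coef. rewrite coth_coef_0. right; f_equal; unfold Rdiv; simpl; ring.
Qed.

Lemma ex_series_bern_sum' (r : R) : 0 <= r < 2 * PI ->
  ex_series (fun n => Rabs (bern_sum_coef n * INR (S n)) * r ^ n).
Proof.
  intros Hr. apply ex_series_dominated with (fun n => 2 * (Rabs (coth_coef n) * r ^ n)).
  - intros n. rewrite Rabs_mult, Rabs_Rabsolu, (Rabs_pos_eq (r ^ n)) by (apply pow_le; lra).
    rewrite <- Rmult_assoc. apply Rmult_le_compat_r; [apply pow_le; lra|].
    apply bern_sum'_coef_bound.
  - now apply ex_series_Rscal, ex_series_coth_pow.
Qed.

Lemma ex_series_bern_sum (r : R) : 0 <= r <= 2 * PI ->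
  ex_series (fun n => Rabs (bern_sum_coef n) * r ^ S n).
Proof.
  intros Hr.
  apply ex_series_dominated with
    (fun n => 2 * (cot_coef n / (INR n * INR (S n)) * (2 * PI) ^ S n)).
  - intros n. rewrite Rabs_mult, Rabs_Rabsolu, (Rabs_pos_eq (r ^ S n)) by (apply pow_le; lra).
    replace (Rabs (bern_sum_coef n)) with (2 * (cot_coef n / (INR n * INR (S n)))).
    + rewrite <- Rmult_assoc. apply Rmult_le_compat_l; [|apply pow_incr; lra].
      destruct n as [|n]; [rewrite cot_coef_0; unfold Rdiv; lra|].
      apply Rmult_le_pos; [lra|]. apply Rdiv_le_0_compat; [apply cot_coef_pos|].
      apply Rmult_lt_0_compat; apply lt_0_INR; lia.
    + rewrite <- Rabs_coth_coef. unfold bern_sum_coef. destruct n as [|n].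
      * rewrite coth_coef_0. unfold Rdiv.
        repeat (rewrite Rmult_0_r || rewrite Rmult_0_l || rewrite Rabs_R0). reflexivity.
      * unfold Rdiv. rewrite !Rabs_mult, (Rabs_pos_eq 2) by lra.
        rewrite (Rabs_pos_eq (/ _)); [ring|]. left. apply Rinv_0_lt_compat.
        apply Rmult_lt_0_compat; apply lt_0_INR; lia.
  - apply ex_series_Rscal, ex_series_cot_coef_boundary.
Qed.

Lemma is_Cseries_bern_sum (w : C) : Cmod w <= 2 * PI ->
  is_Cseries (fun n => RtoC (bern_sum_coef n) * Cpow w (S n))%C (bern_sum w).
Proof.
  intros Hw. apply Cseries_correct with (fun n => Rabs (bern_sum_coef n) * Cmod w ^ S n).
  - intros k. rewrite Cmod_coef_pow. apply Rle_refl.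
  - apply ex_series_bern_sum. split; [apply Cmod_ge_0|exact Hw].
Qed.

Lemma is_Cderive_bern_sum (w : C) : Cmod w < 2 * PI ->
  is_Cderive bern_sum w (bern_sum' w).
Proof.
  intros Hw. pose proof (Cmod_ge_0 w).
  apply (is_Cderive_power_series bern_sum_coef S w ((Cmod w + 2 * PI) / 2)); [lra| |].
  - apply ex_series_bern_sum; lra.
  - apply ex_series_bern_sum'; lra.
Qed.

Lemma is_Cderive_bern_sum' (w : C) : Cmod w < 2 * PI ->
  is_Cderive bern_sum' w (RtoC 2 * coth_quot w)%C.
Proof.
  intros Hw. pose proof (Cmod_ge_0 w).
  set (r := (Cmod w + 2 * PI) / 2). assert (Hr : Cmod w < r < 2 * PI) by (unfold r; lra).
  replace (RtoC 2 * coth_quot w)%C with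
    (Cseries (fun n => RtoC (bern_sum_coef n * INR (S n) * INR n) * Cpow w (pred n))%C).
  - apply (is_Cderive_power_series (fun n => bern_sum_coef n * INR (S n)) (fun n => n) w r);
      [lra|apply ex_series_bern_sum'; lra|].
    apply ex_series_dominated with (fun n => 2 * (Rabs (coth_coef n) * r ^ pred n)).
    + intros n. rewrite Rabs_mult, Rabs_Rabsolu, (Rabs_pos_eq (r ^ pred n))
        by (apply pow_le; lra).
      rewrite bern_sum_coef_mult, Rabs_mult, (Rabs_pos_eq 2) by lra. lra.
    + apply ex_series_Rscal, ex_series_coth_pow_pred; lra.
  - apply is_Cseries_unique.
    assert (H1 : is_Cseries (fun n => RtoC (coth_coef n) * Cpow w (pred n))%C (coth_quot w)).
    { apply Cseries_correct with (fun n => Rabs (coth_coef n) * Cmod w ^ pred n).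
      - intros k. rewrite Cmod_coef_pow. apply Rle_refl.
      - apply ex_series_coth_pow_pred; lra. }
    generalize (is_Cseries_mult_l (RtoC 2) _ _ H1). apply is_Cseries_ext; intros n.
    rewrite bern_sum_coef_mult, RtoC_mult. ring.
Qed.

(** * Polylogarithms *)

(** A general order [j], since each derivative in [w] of the polylogarithm of [exp w] lowers it by
    one; for [j = 2] this is [Li2_term] by conversion. *)
Definition polylog_term (j : nat) (z : C) (k : nat) : C :=
  match k with
  | O => RtoC 0
  | S _ => (Cpow z k / RtoC (INR k ^ j))%C
  end.

Lemma INR_S_pow_pos (n j : nat) : 0 < INR (S n) ^ j.
Proof. apply pow_lt, lt_0_INR; lia. Qed.

Lemma RtoC_INR_S_pow (n j : nat) : RtoC (INR (S n) ^ j) <> RtoC 0.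
Proof. intros H. apply RtoC_inj in H. pose proof (INR_S_pow_pos n j). lra. Qed.

Lemma Cmod_polylog_term (j k : nat) (z : C) : Cmod (polylog_term j z k) <= Cmod z ^ k.
Proof.
  destruct k as [|k]; unfold polylog_term; [rewrite Cmod_0; simpl; lra|].
  rewrite Cmod_div, Cmod_pow, Cmod_R by apply RtoC_INR_S_pow.
  pose proof (INR_S_pow_pos k j). rewrite Rabs_pos_eq by lra.
  apply Rle_div_l; [lra|]. rewrite <- (Rmult_1_r (Cmod z ^ S k)) at 1.
  apply Rmult_le_compat_l; [apply pow_le, Cmod_ge_0|].
  rewrite <- (pow1 j). apply pow_incr. rewrite S_INR. pose proof (pos_INR k). lra.
Qed.

Lemma ex_series_geom_exp (x : R) : x < 0 -> ex_series (fun k => exp x ^ k).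
Proof.
  intros Hx. apply ex_series_geom. rewrite Rabs_pos_eq by (left; apply exp_pos).
  rewrite <- exp_0. now apply exp_increasing.
Qed.

Lemma is_Cseries_polylog (j : nat) (w : C) : Re w < 0 ->
  is_Cseries (polylog_term j (Cexp w)) (Cseries (polylog_term j (Cexp w))).
Proof.
  intros Hw. apply Cseries_correct with (fun k => exp (Re w) ^ k).
  - intros k. rewrite <- Cmod_Cexp. apply Cmod_polylog_term.
  - now apply ex_series_geom_exp.
Qed.

Lemma is_Cderive_polylog_term (j k : nat) (w : C) :
  is_Cderive (fun u => polylog_term (S j) (Cexp u) k) w (polylog_term j (Cexp w) k).
Proof.
  destruct k as [|k].
  { exact (is_Cderive_const (RtoC 0) w). }
  unfold polylog_term.
  apply (is_Cderive_ext (fun u => RtoC (/ INR (S k) ^ S j) * Cpow (Cexp u) (S k))%C).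
  - intros u. rewrite RtoC_inv; [unfold Cdiv; ring|].
    pose proof (INR_S_pow_pos k (S j)). lra.
  - replace (Cpow (Cexp w) (S k) / RtoC (INR (S k) ^ j))%C with
      (RtoC (/ INR (S k) ^ S j) *
        (RtoC (INR (S k)) * Cpow (Cexp w) (pred (S k)) * Cexp w))%C.
    + apply is_Cderive_mult_l, is_Cderive_pow, is_Cderive_Cexp.
    + simpl pred. rewrite Cpow_S.
      assert (H : RtoC (/ INR (S k) ^ S j) = (/ (RtoC (INR (S k)) * RtoC (INR (S k) ^ j)))%C).
      { rewrite <- RtoC_mult, <- RtoC_inv; [reflexivity|].
        pose proof (INR_S_pow_pos k (S j)). simpl in *. lra. }
      rewrite H. field. split; [apply RtoC_INR_S_pow|].
      intros E. apply RtoC_inj in E. revert E. apply not_0_INR; lia.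
Qed.

(** On the disc of radius [- Re w / 2] around [w] one has [Re u < Re w / 2], which yields a
    geometric majorant for both orders. *)
Lemma is_Cderive_polylog (j : nat) (w : C) : Re w < 0 ->
  is_Cderive (fun u => Cseries (polylog_term (S j) (Cexp u))) w
    (Cseries (polylog_term j (Cexp w))).
Proof.
  intros Hw.
  apply (is_Cderive_Cseries (fun k u => polylog_term (S j) (Cexp u) k)
    (fun k u => polylog_term j (Cexp u) k) (fun k => exp (Re w / 2) ^ k) w (- Re w / 2)).
  - lra.
  - intros k u _. apply is_Cderive_polylog_term.
  - intros k u Hu.
    assert (Hb : forall i, Cmod (polylog_term i (Cexp u) k) <= exp (Re w / 2) ^ k).
    { intros i. eapply Rle_trans; [apply Cmod_polylog_term|]. rewrite Cmod_Cexp.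
      apply pow_incr. split; [left; apply exp_pos|].
      pose proof (re_le_Cmod (u - w)) as H. apply Rabs_le_between in H.
      change (Re (u - w)) with (Re u - Re w) in H.
      left. apply exp_increasing. lra. }
    split; apply Hb.
  - apply ex_series_geom_exp; lra.
Qed.

(** The geometric series in a form without division; it is solved for the sum once [Cexp w <> 1] is
    known. *)
Lemma polylog_0 (w : C) : Re w < 0 ->
  (Cseries (polylog_term 0 (Cexp w)) =
   Cexp w * (RtoC 1 + Cseries (polylog_term 0 (Cexp w))))%C.
Proof.
  intros Hw. pose proof (is_Cseries_polylog 0 w Hw) as H.
  set (L := Cseries _) in *. set (q := Cexp w) in *.
  transitivity (L - polylog_term 0 q 0)%C; [simpl; ring|].
  rewrite <- (is_Cseries_unique _ _ (is_Cseries_incr_1 _ _ H)).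
  apply is_Cseries_unique.
  generalize (is_Cseries_mult_l q _ _ (is_Cseries_plus _ _ _ _ (is_Cseries_delta 0 q) H)).
  apply is_Cseries_ext; intros [|k]; unfold delta, polylog_term; simpl; field;
    repeat split; intros E; apply RtoC_inj in E; lra.
Qed.

Lemma PSeries_ln (q : R) : 0 <= q < 1 -> PSeries (fun n => / INR n) q = - ln (1 - q).
Proof.
  intros Hq.
  (* The coefficient at [n = 0] is [/ 0], which is [0] by convention. *)
  set (a := fun n => match n with O => 0 | S _ => / INR n end).
  rewrite (PSeries_ext _ a) by (intros [|n]; [apply Rinv_0|reflexivity]).
  assert (Ha : forall n, Rabs (a n) <= 1 * INR (S n)).
  { intros n. rewrite S_INR. pose proof (pos_INR n). unfold a.
    destruct n as [|n]; [rewrite Rabs_R0; lra|].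
    pose proof (inv_INR_S_bound n). rewrite Rabs_pos_eq; lra. }
  enough (H : PSeries a 0 + ln (1 - 0) = PSeries a q + ln (1 - q)).
  { rewrite Rminus_0_r, ln_1, PSeries_0 in H. unfold a in H at 1. lra. }
  assert (Hd : forall t, 0 <= t <= q -> is_derive (fun t => PSeries a t + ln (1 - t)) t 0).
  { intros t Ht. assert (Ht1 : Rabs t < 1) by (rewrite Rabs_pos_eq; lra).
    replace 0 with (PSeries (PS_derive a) t + - / (1 - t)).
    - apply is_derive_Rplus.
      + apply is_derive_PSeries. now apply (CV_radius_gt _ _ _ Ha).
      + auto_derive; [lra|field; lra].
    - rewrite (PSeries_ext _ (fun _ => 1)).
      + unfold PSeries. rewrite (Series_ext _ (fun n => t ^ n)) by (intros; ring).
        rewrite Series_geom by assumption. ring.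
      + intros n. unfold PS_derive, a. field. apply not_0_INR; lia. }
  apply Rle_antisym.
  - apply (is_derive_le (fun t => PSeries a t + ln (1 - t)) (fun _ => 0));
      [lra|exact Hd|intros; lra].
  - apply Ropp_le_cancel.
    apply (is_derive_le (fun t => - (PSeries a t + ln (1 - t))) (fun _ => 0));
      [lra| |intros; lra].
    intros t Ht. rewrite <- Ropp_0.
    apply (is_derive_opp (K := R_AbsRing) (V := R_NormedModule)). now apply Hd.
Qed.

Lemma Cexp_RtoC (x : R) : Cexp (RtoC x) = RtoC (exp x).
Proof.
  unfold Cexp, RtoC, Re, Im; simpl. rewrite cos_0, sin_0. f_equal; ring.
Qed.

(** The negative real axis is enough, since the limit of [dilog_rhs'] at [0] is taken along it. *)
Lemma polylog_1_real (x : R) : x < 0 ->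
  Cseries (polylog_term 1 (Cexp (RtoC x))) = RtoC (- ln (1 - exp x)).
Proof.
  intros Hx. assert (Hq : 0 <= exp x < 1).
  { split; [left; apply exp_pos|]. rewrite <- exp_0. now apply exp_increasing. }
  rewrite <- PSeries_ln by assumption.
  assert (Hk : forall k, polylog_term 1 (Cexp (RtoC x)) k = RtoC (/ INR k * exp x ^ k)).
  { intros [|k]; unfold polylog_term.
    - simpl INR. rewrite Rinv_0. f_equal; ring.
    - rewrite Cexp_RtoC, <- RtoC_pow, pow_1, <- RtoC_div; [f_equal; unfold Rdiv; ring|].
      apply not_0_INR; lia. }
  rewrite (Cseries_ext _ _ Hk). unfold Cseries, RtoC, Re, Im; simpl. f_equal.
  destruct is_Cseries_0 as [_ H]. now apply is_series_unique.
Qed.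

(** * The logarithm *)

Lemma Carg_pos (x y : R) : 0 < x -> Carg (x, y) = atan (y / x).
Proof. intros Hx. unfold Carg; simpl. destruct (Rlt_dec 0 x); [reflexivity|lra]. Qed.

Lemma Clog_pos (x y : R) : 0 < x -> Clog (x, y) = (ln (sqrt (x ^ 2 + y ^ 2)), atan (y / x)).
Proof. intros Hx. unfold Clog. now rewrite Carg_pos. Qed.

Lemma Clog_RtoC (x : R) : 0 < x -> Clog (RtoC x) = RtoC (ln x).
Proof.
  intros Hx. unfold RtoC at 1. rewrite Clog_pos by assumption. unfold RtoC.
  replace (x ^ 2 + 0 ^ 2) with (x ^ 2) by ring. rewrite sqrt_pow2 by lra.
  unfold Rdiv. now rewrite Rmult_0_l, atan_0.
Qed.

(** [- w] lies in the right half-plane, where [Carg] is a single [atan] and no cut is met; a short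
    piece of any line through it stays there. *)
Lemma is_Cderive_Clog_opp (w : C) : Re w < 0 -> is_Cderive (fun u => Clog (- u)%C) w (/ w)%C.
Proof.
  intros Hw [d1 d2]. destruct w as [a b]. unfold Re in Hw; simpl in Hw.
  assert (Hab : 0 < a ^ 2 + b ^ 2) by nra.
  assert (Hloc : locally 0 (fun s : R => 0 < - (a + (s * d1 - 0 * d2)))).
  { assert (He : 0 < - a / (Rabs d1 + 1))
      by (apply Rdiv_lt_0_compat; [lra|pose proof (Rabs_pos d1); lra]).
    exists (mkposreal _ He). intros s Hs. change (Rabs (s - 0) < - a / (Rabs d1 + 1)) in Hs.
    rewrite Rminus_0_r in Hs. pose proof (Rabs_pos d1). pose proof (Rabs_pos s).
    apply Rlt_div_r in Hs; [|lra].
    assert (Rabs (s * d1) < - a) by (rewrite Rabs_mult; nra).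
    apply Rabs_lt_between in H1. lra. }
  split.
  - apply (is_derive_ext_loc (fun s => ln (sqrt ((- (a + (s * d1 - 0 * d2))) ^ 2 +
      (- (b + (s * d2 + 0 * d1))) ^ 2)))).
    + revert Hloc. apply filter_imp. intros s Hs.
      unfold Cplus, Cmult, Copp, RtoC, Re; simpl fst; simpl snd.
      reflexivity.
    + auto_derive.
      * replace (a + (0 * d1 + - (0 * d2))) with a by ring.
        replace (b + (0 * d2 + 0 * d1)) with b by ring.
        assert (0 < - a * (- a * 1) + - b * (- b * 1)) by nra.
        repeat split; try assumption. now apply sqrt_lt_R0.
      * replace (a + (0 * d1 + - (0 * d2))) with a by ring.
        replace (b + (0 * d2 + 0 * d1)) with b by ring.
        replace (- a * (- a * 1) + - b * (- b * 1)) with (a ^ 2 + b ^ 2) by ring.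
        unfold Cinv, Cmult, Re; simpl fst; simpl snd.
        set (D := a ^ 2 + b ^ 2) in *.
        assert (Hs : 0 < sqrt D) by now apply sqrt_lt_R0.
        assert (Hss : sqrt D * sqrt D = D) by (apply sqrt_sqrt; lra).
        transitivity ((a * d1 + b * d2) / (sqrt D * sqrt D)); [simpl; field; lra|].
        rewrite Hss. match goal with |- ?x = ?y => change (x = y :> R) end.
        change (a * (a * 1) + b * (b * 1)) with D. field; lra.
  - apply (is_derive_ext_loc (fun s => atan (- (b + (s * d2 + 0 * d1)) /
      - (a + (s * d1 - 0 * d2))))).
    + revert Hloc. apply filter_imp. intros s Hs.
      unfold Cplus, Cmult, Copp, RtoC, Im; simpl fst; simpl snd.
      now rewrite Carg_pos.
    + auto_derive.
      * replace (a + (0 * d1 + - (0 * d2))) with a by ring. lra.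
      * replace (a + (0 * d1 + - (0 * d2))) with a by ring.
        replace (b + (0 * d2 + 0 * d1)) with b by ring.
        unfold Cinv, Cmult, Im; simpl fst; simpl snd. simpl.
        field. simpl in Hab. split; nra.
Qed.

(** * The right-hand side and its derivatives *)

Definition dilog_rhs (w : C) : C :=
  (RtoC (PI ^ 2 / 3) - RtoC (1 / 2) * Cpow w 2
   + RtoC 2 * w * (RtoC 1 - Clog (- w)) - RtoC 2 * Li2_series (Cexp w))%C.

(** The constants are gone: [2 w (1 - ln (- w))] has derivative [2 (1 - ln (- w)) - 2]. *)
Definition dilog_rhs' (w : C) : C :=
  (RtoC (-1) * w - RtoC 2 * Clog (- w) - RtoC 2 * Cseries (polylog_term 1 (Cexp w)))%C.

Lemma Re_neg_neq_0 (w : C) : Re w < 0 -> w <> RtoC 0.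
Proof. intros H E. rewrite E in H. unfold Re in H; simpl in H. lra. Qed.

Lemma is_Cderive_Li2_series (w : C) : Re w < 0 ->
  is_Cderive (fun u => Li2_series (Cexp u)) w (Cseries (polylog_term 1 (Cexp w))).
Proof. exact (is_Cderive_polylog 1 w). Qed.

Lemma is_Cderive_dilog_rhs (w : C) : Re w < 0 -> is_Cderive dilog_rhs w (dilog_rhs' w).
Proof.
  intros Hw. pose proof (Re_neg_neq_0 w Hw) as Hw0.
  replace (dilog_rhs' w) with
    (RtoC 0 - RtoC (1 / 2) * (RtoC (INR 2) * Cpow w (pred 2) * RtoC 1)
     + (RtoC 2 * RtoC 1 * (RtoC 1 - Clog (- w)) + RtoC 2 * w * (RtoC 0 - / w))
     - RtoC 2 * Cseries (polylog_term 1 (Cexp w)))%C.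
  - apply is_Cderive_minus; [apply is_Cderive_plus; [apply is_Cderive_minus|]|].
    + apply is_Cderive_const.
    + apply is_Cderive_mult_l, (is_Cderive_pow (fun u => u)), is_Cderive_id.
    + apply (is_Cderive_mult (fun u => RtoC 2 * u)%C (fun u => RtoC 1 - Clog (- u))%C).
      * apply is_Cderive_mult_l, is_Cderive_id.
      * apply is_Cderive_minus; [apply is_Cderive_const|now apply is_Cderive_Clog_opp].
    + now apply is_Cderive_mult_l, is_Cderive_Li2_series.
  - unfold dilog_rhs'. rewrite RtoC_div by lra. simpl pred. rewrite Cpow_1_r. simpl INR.
    replace (RtoC (1 + 1)) with (RtoC 2) by (f_equal; ring).
    field. exact Hw0.
Qed.

Lemma is_Cderive_dilog_rhs' (w : C) : Re w < 0 -> Cmod w < 2 * PI ->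
  is_Cderive dilog_rhs' w (RtoC 2 * coth_quot w)%C.
Proof.
  intros Hw Hw2. pose proof (Re_neg_neq_0 w Hw) as Hw0.
  pose proof (coth_quot_spec w Hw2) as HQ. pose proof (polylog_0 w Hw) as HL.
  set (L := Cseries (polylog_term 0 (Cexp w))) in *.
  (* [Re w < 0] makes the modulus of [Cexp w] less than [1], so both quotients by [q - 1] and
     [1 - q] are legitimate. *)
  assert (Hq1 : (Cexp w - RtoC 1)%C <> RtoC 0).
  { intros E. assert (E1 : Cexp w = RtoC 1).
    { replace (Cexp w) with (Cexp w - RtoC 1 + RtoC 1)%C by ring. rewrite E; ring. }
    assert (E2 : Cmod (Cexp w) = 1) by (rewrite E1; apply Cmod_1).
    rewrite Cmod_Cexp in E2. assert (exp (Re w) < 1) by (rewrite <- exp_0; now apply exp_increasing).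
    lra. }
  assert (H2 : RtoC 2 <> RtoC 0) by (intros E; apply RtoC_inj in E; lra).
  assert (Hval : (RtoC 2 * coth_quot w = RtoC (-1) * RtoC 1 - RtoC 2 * / w - RtoC 2 * L)%C).
  { set (q := Cexp w) in *. set (Q := coth_quot w) in *.
    assert (HQ' : Q = ((w / (q - RtoC 1) - RtoC 1 + w / RtoC 2) / w)%C).
    { transitivity (((w * Q + RtoC 1 - w / RtoC 2) * (q - RtoC 1) / (q - RtoC 1)
        - RtoC 1 + w / RtoC 2) / w)%C; [field; auto|]. now rewrite HQ. }
    assert (HL' : L = (q / (RtoC 1 - q))%C).
    { assert (Hq2 : (RtoC 1 - q)%C <> RtoC 0).
      { intros E. apply Hq1. replace (q - RtoC 1)%C with (- (RtoC 1 - q))%C by ring.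
        rewrite E; ring. }
      transitivity ((L - q * L) / (RtoC 1 - q))%C; [field; exact Hq2|].
      rewrite HL at 1. field; exact Hq2. }
    rewrite HQ', HL'. field. repeat split; try assumption.
    intros E. apply Hq1. replace (q - RtoC 1)%C with (- (RtoC 1 - q))%C by ring.
    rewrite E; ring. }
  rewrite Hval.
  apply is_Cderive_minus; [apply is_Cderive_minus|].
  - apply is_Cderive_mult_l, is_Cderive_id.
  - now apply is_Cderive_mult_l, is_Cderive_Clog_opp.
  - now apply is_Cderive_mult_l, is_Cderive_polylog.
Qed.

Definition half_disc (w : C) : Prop := Re w < 0 /\ Cmod w < 2 * PI.

Lemma half_disc_convex (w1 w2 : C) (t : R) : half_disc w1 -> half_disc w2 -> 0 <= t <= 1 ->
  half_disc (w1 + RtoC t * (w2 - w1))%C.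
Proof.
  intros [H1 H2] [H3 H4] Ht. split.
  - replace (Re (w1 + RtoC t * (w2 - w1))%C) with ((1 - t) * Re w1 + t * Re w2)
      by (unfold Re; simpl; ring).
    (* One of the weights [t] and [1 - t] is at least [1 / 2], which keeps the inequality strict. *)
    destruct (Rle_dec t (/ 2)); nra.
  - replace (w1 + RtoC t * (w2 - w1))%C with (RtoC (1 - t) * w1 + RtoC t * w2)%C
      by (rewrite RtoC_minus; ring).
    eapply Rle_lt_trans; [apply Cmod_triangle|].
    rewrite !Cmod_mult, !Cmod_R, !Rabs_pos_eq by lra.
    destruct (Rle_dec t (/ 2)); nra.
Qed.

(** * Limits of complex sequences *)

Definition is_Clim (u : nat -> C) (l : C) : Prop :=
  is_lim_seq (fun n => Re (u n)) (Re l) /\ is_lim_seq (fun n => Im (u n)) (Im l).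

Lemma is_Clim_const (c : C) : is_Clim (fun _ => c) c.
Proof. split; apply is_lim_seq_const. Qed.

Lemma is_Clim_unique (u : nat -> C) (l m : C) : is_Clim u l -> is_Clim u m -> l = m.
Proof.
  intros [H1 H2] [H3 H4]. apply is_lim_seq_unique in H1, H2, H3, H4.
  rewrite H1 in H3. rewrite H2 in H4. injection H3; injection H4.
  destruct l, m; unfold Re, Im; simpl; congruence.
Qed.

Lemma is_Clim_ext (u v : nat -> C) (l : C) :
  (forall n, u n = v n) -> is_Clim u l -> is_Clim v l.
Proof.
  intros H [H1 H2]. split; [revert H1|revert H2]; apply is_lim_seq_ext; intros n;
    now rewrite H.
Qed.

Lemma is_Clim_plus (u v : nat -> C) (l m : C) :
  is_Clim u l -> is_Clim v m -> is_Clim (fun n => u n + v n)%C (l + m)%C.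
Proof. intros [H1 H2] [H3 H4]. split; now apply is_lim_seq_plus'. Qed.

Lemma is_Clim_minus (u v : nat -> C) (l m : C) :
  is_Clim u l -> is_Clim v m -> is_Clim (fun n => u n - v n)%C (l - m)%C.
Proof. intros [H1 H2] [H3 H4]. split; now apply is_lim_seq_minus'. Qed.

Lemma is_Clim_mult (u v : nat -> C) (l m : C) :
  is_Clim u l -> is_Clim v m -> is_Clim (fun n => u n * v n)%C (l * m)%C.
Proof.
  intros [H1 H2] [H3 H4]. split.
  - apply is_lim_seq_minus'; now apply is_lim_seq_mult'.
  - apply is_lim_seq_plus'; now apply is_lim_seq_mult'.
Qed.

Lemma is_Clim_pow (u : nat -> C) (l : C) (k : nat) :
  is_Clim u l -> is_Clim (fun n => Cpow (u n) k) (Cpow l k).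
Proof.
  intros H. induction k as [|k IH]; [apply is_Clim_const|now apply is_Clim_mult].
Qed.

Lemma is_Clim_Cexp (u : nat -> C) (l : C) :
  is_Clim u l -> is_Clim (fun n => Cexp (u n)) (Cexp l).
Proof.
  intros [H1 H2]. split; apply is_lim_seq_mult'.
  1, 3: apply (is_lim_seq_continuous exp); [apply derivable_continuous_pt, derivable_pt_exp|exact H1].
  - apply (is_lim_seq_continuous cos); [apply derivable_continuous_pt, derivable_pt_cos|exact H2].
  - apply (is_lim_seq_continuous sin); [apply derivable_continuous_pt, derivable_pt_sin|exact H2].
Qed.

Lemma is_Clim_Cseries (f : nat -> nat -> C) (l : nat -> C) (M : nat -> R) :
  (forall k, is_Clim (f k) (l k)) -> (forall k n, Cmod (f k n) <= M k) ->
  (forall k, Cmod (l k) <= M k) -> ex_series M ->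
  is_Clim (fun n => Cseries (fun k => f k n)) (Cseries l).
Proof.
  intros H HfM HlM HM. split.
  - apply (filterlim_Series eventually (fun k n => Re (f k n)) (fun k => Re (l k)) M).
    + intros k. apply H.
    + exists 0%nat. intros n _ k. eapply Rle_trans; [apply re_le_Cmod|apply HfM].
    + intros k. eapply Rle_trans; [apply re_le_Cmod|apply HlM].
    + exact HM.
  - apply (filterlim_Series eventually (fun k n => Im (f k n)) (fun k => Im (l k)) M).
    + intros k. apply H.
    + exists 0%nat. intros n _ k. eapply Rle_trans; [apply im_le_Cmod|apply HfM].
    + intros k. eapply Rle_trans; [apply im_le_Cmod|apply HlM].
    + exact HM.
Qed.

Lemma is_Clim_RtoC (u : nat -> R) (l : R) :
  is_lim_seq u l -> is_Clim (fun n => RtoC (u n)) (RtoC l).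
Proof. intros H. split; [exact H|apply is_lim_seq_const]. Qed.

(** * The constants of integration *)

(** The logarithmic singularities of [Clog (- w)] and of the polylogarithm of order 1 cancel at [0],
    so the constant difference can be evaluated as a limit along [x n]. *)
Lemma bern_sum'_dilog_rhs' (w : C) : half_disc w -> bern_sum' w = dilog_rhs' w.
Proof.
  intros Hw.
  set (D := fun u => (bern_sum' u - dilog_rhs' u)%C).
  set (x := fun n : nat => - / INR (S n)).
  assert (Hx : forall n, -1 <= x n < 0) by (intros n; pose proof (inv_INR_S_bound n); unfold x; lra).
  assert (Hx0 : is_lim_seq x 0).
  { replace (Finite 0) with (Finite (- 0)) by (f_equal; ring).
    apply (is_lim_seq_opp _ 0), is_lim_seq_inv_INR_S. }
  assert (Hpi : 1 < PI) by (pose proof PI2_1; lra).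
  assert (Hxm : forall n, Cmod (RtoC (x n)) <= 1).
  { intros n. rewrite Cmod_R. specialize (Hx n). apply Rabs_le; lra. }
  assert (HxD : forall n, half_disc (RtoC (x n))).
  { intros n. specialize (Hx n). split; [unfold Re; simpl; lra|].
    specialize (Hxm n). lra. }
  assert (HD : forall n, D (RtoC (x n)) = D w).
  { intros n. apply is_Cderive_zero_const. intros t Ht.
    destruct (half_disc_convex _ _ t (HxD n) Hw Ht) as [H1 H2].
    set (u := (RtoC (x n) + _)%C) in *.
    replace (RtoC 0) with (RtoC 2 * coth_quot u - RtoC 2 * coth_quot u)%C by ring.
    apply is_Cderive_minus; [now apply is_Cderive_bern_sum'|now apply is_Cderive_dilog_rhs']. }
  assert (HS : is_Clim (fun n => bern_sum' (RtoC (x n))) (RtoC 0)).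
  { rewrite <- (is_Cseries_unique _ _ is_Cseries_0).
    apply (is_Clim_Cseries
      (fun k n => RtoC (bern_sum_coef k * INR (S k)) * Cpow (RtoC (x n)) k)%C
      (fun _ => RtoC 0) (fun k => Rabs (bern_sum_coef k * INR (S k)) * 1 ^ k)).
    - intros k. destruct k as [|k].
      + unfold bern_sum_coef. rewrite coth_coef_0.
        apply is_Clim_ext with (fun _ => RtoC 0); [|apply is_Clim_const].
        intros n. replace (2 * 0 / (INR 0 * INR 1) * INR 1) with 0 by (unfold Rdiv; ring).
        ring.
      + replace (RtoC 0) with (RtoC (bern_sum_coef (S k) * INR (S (S k))) * Cpow (RtoC 0) (S k))%C
          by (rewrite Cpow_S; ring).
        apply is_Clim_mult; [apply is_Clim_const|].
        now apply is_Clim_pow, is_Clim_RtoC.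
    - intros k n. now apply Cmod_coef_pow_le.
    - intros k. rewrite Cmod_0, pow1, Rmult_1_r. apply Rabs_pos.
    - apply ex_series_bern_sum'; lra. }
  assert (HR : is_Clim (fun n => dilog_rhs' (RtoC (x n))) (RtoC 0)).
  (* The two logarithms merge into that of a difference quotient of [exp] at [0], which tends to
     [1]. *)
  { apply is_Clim_ext with
      (fun n => RtoC (- x n + 2 * ln ((exp (0 + x n) - exp 0) / x n))).
    - intros n. specialize (Hx n). unfold dilog_rhs'.
      rewrite polylog_1_real, <- RtoC_opp, Clog_RtoC by lra.
      rewrite <- !RtoC_mult, <- !RtoC_minus. f_equal.
      rewrite Rplus_0_l, exp_0.
      assert (exp (x n) < 1) by (rewrite <- exp_0; apply exp_increasing; lra).
      replace ((exp (x n) - 1) / x n) with ((1 - exp (x n)) / - x n) by (field; lra).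
      rewrite ln_div by lra. ring.
    - replace (RtoC 0) with (RtoC (- 0 + 2 * ln 1)) by (rewrite ln_1; f_equal; ring).
      apply is_Clim_RtoC. apply is_lim_seq_plus'.
      + now apply (is_lim_seq_opp _ 0).
      + apply is_lim_seq_mult'; [apply is_lim_seq_const|].
        apply (is_lim_seq_continuous ln).
        * apply derivable_continuous_pt. exists (/ 1). apply derivable_pt_lim_ln; lra.
        * pose proof (is_derive_exp 0) as He. rewrite exp_0 in He.
          apply (proj1 (is_derive_quotient exp 0 1)) in He. rewrite exp_0 in He.
          rewrite exp_0.
          apply (filterlim_comp _ _ _ x _ _ _ _) with (2 := He).
          intros P [d Hd]. destruct (proj1 (filterlim_locally _ _) Hx0 d) as [N HN].
          exists N. intros n Hn. apply Hd; [now apply HN|]. specialize (Hx n). lra. }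
  pose proof (is_Clim_minus _ _ _ _ HS HR) as HDl.
  assert (H0 : D w = (RtoC 0 - RtoC 0)%C).
  { apply is_Clim_unique with (fun n => D (RtoC (x n))); [|exact HDl].
    apply is_Clim_ext with (fun _ => D w); [intros n; now rewrite HD|apply is_Clim_const]. }
  unfold D in H0.
  replace (bern_sum' w) with (bern_sum' w - dilog_rhs' w + dilog_rhs' w)%C by ring.
  rewrite H0. ring.
Qed.

Lemma bern_sum_minus_dilog_rhs_const (w1 w2 : C) : half_disc w1 -> half_disc w2 ->
  (bern_sum w1 - dilog_rhs w1 = bern_sum w2 - dilog_rhs w2)%C.
Proof.
  intros H1 H2. apply (is_Cderive_zero_const (fun w => bern_sum w - dilog_rhs w)%C).
  intros t Ht. pose proof (half_disc_convex _ _ t H1 H2 Ht) as Hu.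
  set (u := (w1 + _)%C) in *.
  replace (RtoC 0) with (bern_sum' u - dilog_rhs' u)%C
    by (rewrite bern_sum'_dilog_rhs' by assumption; ring).
  destruct Hu. apply is_Cderive_minus; [now apply is_Cderive_bern_sum|now apply is_Cderive_dilog_rhs].
Qed.

(** Through [atan (q / p) = PI / 2 - atan (p / q)], whose last quotient tends to [0]. *)
Lemma is_lim_seq_atan_quotient (p q : nat -> R) (l : R) :
  (forall n, 0 < p n) -> is_lim_seq p 0 -> is_lim_seq q l -> 0 < l ->
  is_lim_seq (fun n => atan (q n / p n)) (PI / 2).
Proof.
  intros Hp Hp0 Hq Hl.
  apply (is_lim_seq_ext_loc (fun n => PI / 2 - atan (p n / q n))).
  - destruct (proj1 (filterlim_locally _ _) Hq (mkposreal l Hl)) as [N HN].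
    exists N. intros n Hn. specialize (HN n Hn). change (Rabs (q n - l) < l) in HN.
    apply Rabs_lt_between in HN. specialize (Hp n).
    rewrite <- atan_inv by (apply Rdiv_lt_0_compat; lra).
    f_equal. field. lra.
  - replace (PI / 2) with (PI / 2 - atan (0 / l)) at 1
      by (unfold Rdiv; rewrite Rmult_0_l, atan_0; ring).
    apply is_lim_seq_minus'; [apply is_lim_seq_const|].
    apply (is_lim_seq_continuous atan).
    + apply derivable_continuous_pt, derivable_pt_atan.
    + apply is_lim_seq_div'; [exact Hp0|exact Hq|lra].
Qed.

(** The limit may lie on the imaginary axis, where [Carg] switches to the separate values [PI / 2]
    and [- (PI / 2)]; these are the limits of [atan (y / x)] from the right. *)
Lemma is_Clim_Clog (u : nat -> C) (l : C) :
  (forall n, 0 < Re (u n)) -> 0 <= Re l -> l <> RtoC 0 -> is_Clim u l ->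
  is_Clim (fun n => Clog (u n)) (Clog l).
Proof.
  intros Hu Hl0 Hl [H1 H2].
  assert (Hm : 0 < Re l ^ 2 + Im l ^ 2).
  { destruct (Req_dec (Re l) 0) as [E1|E1]; [|pose proof (pow2_gt_0 _ E1); pose proof (pow2_ge_0 (Im l)); lra].
    destruct (Req_dec (Im l) 0) as [E2|E2]; [|pose proof (pow2_gt_0 _ E2); pose proof (pow2_ge_0 (Re l)); lra].
    exfalso. apply Hl. destruct l. unfold Re, Im in *; simpl in *. subst. reflexivity. }
  assert (Hre : is_lim_seq (fun n => ln (sqrt (Re (u n) ^ 2 + Im (u n) ^ 2)))
    (ln (sqrt (Re l ^ 2 + Im l ^ 2)))).
  { apply (is_lim_seq_continuous ln).
    - apply derivable_continuous_pt. exists (/ sqrt (Re l ^ 2 + Im l ^ 2)).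
      apply derivable_pt_lim_ln. now apply sqrt_lt_R0.
    - apply (is_lim_seq_continuous sqrt).
      + apply continuity_pt_sqrt. lra.
      + simpl. apply is_lim_seq_plus'; apply is_lim_seq_mult'; try assumption;
          apply is_lim_seq_mult'; try assumption; apply is_lim_seq_const. }
  split; [exact Hre|].
  apply is_lim_seq_ext with (fun n => atan (Im (u n) / Re (u n))).
  { intros n. specialize (Hu n). destruct (u n) as [x y]. unfold Re, Im in *; simpl in *.
    now rewrite Carg_pos. }
  change (Im (Clog l)) with (Carg l).
  destruct (Rle_lt_or_eq_dec _ _ Hl0) as [Hpos|Hzero].
  - replace (Carg l) with (atan (Im l / Re l)).
    + apply (is_lim_seq_continuous atan).
      * apply derivable_continuous_pt, derivable_pt_atan.
      * apply is_lim_seq_div'; [exact H2|exact H1|lra].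
    + destruct l as [x y]. unfold Re, Im in *; simpl in *. now rewrite Carg_pos.
  - rewrite <- Hzero in *.
    destruct (Rtotal_order (Im l) 0) as [Hneg|[E|Hpos]].
    + replace (Carg l) with (- (PI / 2)).
      * apply is_lim_seq_ext with (fun n => - atan (- Im (u n) / Re (u n))).
        { intros n. rewrite Rdiv_opp_l, atan_opp. ring. }
        apply (is_lim_seq_opp _ (PI / 2)).
        apply is_lim_seq_atan_quotient with (- Im l); try assumption; [|lra].
        now apply (is_lim_seq_opp _ (Im l)).
      * unfold Carg. unfold Re, Im in *. rewrite <- Hzero.
        destruct (Rlt_dec 0 0); [lra|]. destruct (Rlt_dec 0 (snd l)); [lra|].
        destruct (Rlt_dec (snd l) 0); lra.
    + exfalso. rewrite E in Hm. lra.
    + replace (Carg l) with (PI / 2).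
      * now apply is_lim_seq_atan_quotient with (Im l).
      * unfold Carg. unfold Re, Im in *. rewrite <- Hzero.
        destruct (Rlt_dec 0 0); [lra|]. destruct (Rlt_dec 0 (snd l)); lra.
Qed.

Lemma ex_series_inv_sq : ex_series (fun k => / INR (S k) ^ 2).
Proof.
  apply ex_series_nonneg with 2.
  - intros n. left. apply Rinv_0_lt_compat, INR_S_pow_pos.
  (* Telescoping, from [1 / (x + 1) ^ 2 <= 1 / x - 1 / (x + 1)]. *)
  - enough (H : forall N, sum_f_R0 (fun k => / INR (S k) ^ 2) N <= 2 - / INR (S N)).
    { intros N. pose proof (inv_INR_S_bound N). specialize (H N). lra. }
    induction N as [|N IH]; [simpl; lra|].
    rewrite tech5. rewrite (S_INR (S N)) in *.
    assert (Hn : 0 < INR (S N)) by (apply lt_0_INR; lia).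
    set (x := INR (S N)) in *.
    enough (/ (x + 1) ^ 2 <= / x - / (x + 1)) by lra.
    replace (/ x - / (x + 1)) with (/ (x * (x + 1))) by (field; lra).
    apply Rinv_le_contravar; nra.
Qed.

Definition inv_sq (k : nat) : R := match k with O => 0 | S _ => / INR k ^ 2 end.

Lemma ex_series_inv_sq0 : ex_series inv_sq.
Proof. apply ex_series_shift, ex_series_inv_sq. Qed.

Lemma Cmod_Li2_term (z : C) (k : nat) : Cmod z <= 1 -> Cmod (Li2_term z k) <= inv_sq k.
Proof.
  intros Hz. destruct k as [|k]; [simpl; rewrite Cmod_0; lra|].
  unfold Li2_term, inv_sq. rewrite Cmod_div, Cmod_pow, Cmod_R by apply (RtoC_INR_S_pow k 2).
  pose proof (INR_S_pow_pos k 2). rewrite Rabs_pos_eq by lra.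
  unfold Rdiv. rewrite <- (Rmult_1_l (/ INR (S k) ^ 2)) at 2.
  apply Rmult_le_compat_r; [left; now apply Rinv_0_lt_compat|].
  rewrite <- (pow1 (S k)). apply pow_incr. split; [apply Cmod_ge_0|exact Hz].
Qed.

Lemma Cmod_Cexp_le_1 (w : C) : Re w <= 0 -> Cmod (Cexp w) <= 1.
Proof.
  intros Hw. rewrite Cmod_Cexp, <- exp_0.
  destruct Hw as [H|H]; [left; now apply exp_increasing|rewrite H; lra].
Qed.

Lemma is_Clim_Li2_series (u : nat -> C) (l : C) :
  (forall n, Cmod (u n) <= 1) -> Cmod l <= 1 -> is_Clim u l ->
  is_Clim (fun n => Li2_series (u n)) (Li2_series l).
Proof.
  intros Hu Hl H.
  apply (is_Clim_Cseries (fun k n => Li2_term (u n) k) (Li2_term l) inv_sq).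
  - intros [|k]; [apply is_Clim_const|].
    apply is_Clim_mult; [now apply is_Clim_pow|apply is_Clim_const].
  - intros k n. now apply Cmod_Li2_term.
  - intros k. now apply Cmod_Li2_term.
  - apply ex_series_inv_sq0.
Qed.

Lemma bern_sum_minus_dilog_rhs_closed (w : C) :
  Re w <= 0 -> w <> RtoC 0 -> Cmod w <= 2 * PI ->
  (bern_sum w - dilog_rhs w = bern_sum (RtoC (-1)) - dilog_rhs (RtoC (-1)))%C.
Proof.
  intros Hre Hw0 Hw. pose proof PI_RGT_0 as Hpi.
  set (e := fun n : nat => / INR (S n)).
  (* Moving [w] towards the interior point [- PI] gives points of the open half-disc, even when [w]
     is on its boundary. *)
  set (u := fun n => (w + RtoC (e n) * (RtoC (- PI) - w))%C).
  assert (He : forall n, 0 < e n <= 1) by (intros n; apply inv_INR_S_bound).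
  assert (Hu : is_Clim u w).
  { replace w with (w + RtoC 0 * (RtoC (- PI) - w))%C at 1 by ring.
    apply is_Clim_plus; [apply is_Clim_const|].
    apply is_Clim_mult; [apply is_Clim_RtoC, is_lim_seq_inv_INR_S|apply is_Clim_const]. }
  assert (HuD : forall n, half_disc (u n)).
  { intros n. specialize (He n). split.
    - replace (Re (u n)) with ((1 - e n) * Re w + e n * - PI)
        by (unfold u, Re; simpl; ring). nra.
    - replace (u n) with (RtoC (1 - e n) * w + RtoC (e n) * RtoC (- PI))%C
        by (unfold u; rewrite RtoC_minus; ring).
      eapply Rle_lt_trans; [apply Cmod_triangle|].
      rewrite !Cmod_mult, !Cmod_R, Rabs_Ropp, !Rabs_pos_eq by lra. nra. }
  assert (H1 : half_disc (RtoC (-1))).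
  { split; [unfold Re; simpl; lra|]. rewrite Cmod_R, Rabs_left by lra.
    pose proof PI2_1; lra. }
  apply is_Clim_unique with (fun n => bern_sum (u n) - dilog_rhs (u n))%C.
  - apply is_Clim_minus.
    + apply (is_Clim_Cseries (fun k n => RtoC (bern_sum_coef k) * Cpow (u n) (S k))%C
        (fun k => RtoC (bern_sum_coef k) * Cpow w (S k))%C
        (fun k => Rabs (bern_sum_coef k) * (2 * PI) ^ S k)).
      * intros k. apply is_Clim_mult; [apply is_Clim_const|now apply is_Clim_pow].
      * intros k n. apply Cmod_coef_pow_le. left; apply HuD.
      * intros k. now apply Cmod_coef_pow_le.
      * apply ex_series_bern_sum; lra.
    + unfold dilog_rhs. apply is_Clim_minus; [apply is_Clim_plus; [apply is_Clim_minus|]|].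
      * apply is_Clim_const.
      * apply is_Clim_mult; [apply is_Clim_const|now apply is_Clim_pow].
      * apply is_Clim_mult; [apply is_Clim_mult; [apply is_Clim_const|exact Hu]|].
        apply is_Clim_minus; [apply is_Clim_const|].
        apply is_Clim_Clog.
        -- intros n. destruct (HuD n) as [H _].
           change (Re (- u n)%C) with (- Re (u n)). lra.
        -- change (Re (- w)%C) with (- Re w). lra.
        -- intros E. apply Hw0. replace w with (- - w)%C by ring. rewrite E; ring.
        -- destruct Hu as [Ha Hb]. split.
           ++ now apply (is_lim_seq_opp _ (Re w)).
           ++ now apply (is_lim_seq_opp _ (Im w)).
      * apply is_Clim_mult; [apply is_Clim_const|].
        apply is_Clim_Li2_series; [| |now apply is_Clim_Cexp].
        -- intros n. apply Cmod_Cexp_le_1. left; apply HuD.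
        -- now apply Cmod_Cexp_le_1.
  - apply is_Clim_ext with (fun _ => (bern_sum (RtoC (-1)) - dilog_rhs (RtoC (-1)))%C).
    + intros n. now apply bern_sum_minus_dilog_rhs_const.
    + apply is_Clim_const.
Qed.

(** * Real and imaginary parts on the axes *)

Lemma Series_0 (a : nat -> R) : (forall k, a k = 0) -> Series a = 0.
Proof.
  intros H. rewrite (Series_ext _ _ H). destruct is_Cseries_0 as [H0 _].
  now apply is_series_unique.
Qed.

(** Only odd powers of [i y] have a nonzero coefficient. *)
Lemma Re_bern_sum_imaginary (y : R) : Re (bern_sum (0, y)) = 0.
Proof.
  apply Series_0. intros n. rewrite Re_RtoC_mult.
  destruct (Nat.odd n) eqn:Hn.
  - unfold bern_sum_coef. rewrite coth_coef_odd by assumption. unfold Rdiv; ring.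
  - assert (Hn' : Nat.even n = true) by (rewrite <- Nat.negb_odd, Hn; reflexivity).
    apply Nat.even_spec in Hn'. destruct Hn' as [m ->].
    rewrite Cpow_S, Cpow_mult_r.
    replace (Cpow (0, y) 2) with (RtoC (- y ^ 2))
      by (rewrite Cpow_S, Cpow_1_r; unfold RtoC, Cmult; simpl; f_equal; ring).
    rewrite <- RtoC_pow. unfold Re; simpl; ring.
Qed.

Lemma Re_dilog_rhs_imaginary (y : R) : 0 < y ->
  Re (dilog_rhs (0, y)) =
  PI ^ 2 / 3 + y ^ 2 / 2 - PI * y - 2 * Re (Li2_series (cos y, sin y)).
Proof.
  intros Hy. unfold dilog_rhs.
  replace (Cexp (0, y)) with (cos y, sin y)
    by (unfold Cexp, Re, Im; simpl; rewrite exp_0; f_equal; ring).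
  assert (HL : Im (Clog (- (0, y))%C) = - (PI / 2)).
  { unfold Clog, Carg, Im; simpl. rewrite Ropp_0.
    destruct (Rlt_dec 0 0); [lra|]. destruct (Rlt_dec 0 (- y)); [lra|].
    destruct (Rlt_dec (- y) 0); lra. }
  destruct (Clog _) as [l1 l2]. unfold Im in HL; simpl in HL. rewrite HL.
  destruct (Li2_series _) as [m1 m2]. unfold Re; simpl. field.
Qed.

(** Odd powers of [i] have no real part, and the term of index [2 m] is [(-1) ^ m / (4 m ^ 2)]. *)
Lemma Re_Li2_series_i :
  Re (Li2_series (0, 1)) = / 4 * Re (Li2_series (RtoC (-1))).
Proof.
  unfold Li2_series. unfold Re at 1 3. simpl fst. rewrite <- Series_scal_l.
  assert (Hi : forall m, Cpow (0, 1) (2 * m) = RtoC ((-1) ^ m)).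
  { intros m. rewrite Cpow_mult_r.
    replace (Cpow (0, 1) 2) with (RtoC (-1))
      by (rewrite Cpow_S, Cpow_1_r; unfold RtoC, Cmult; simpl; f_equal; ring).
    now rewrite RtoC_pow. }
  assert (Hc : is_series (fun k => Re (Li2_term (0, 1) k)) (Series (fun k => Re (Li2_term (0, 1) k)))).
  { apply Series_correct, ex_series_dominated with (2 := ex_series_inv_sq0).
    intros k. eapply Rle_trans; [apply re_le_Cmod|]. apply Cmod_Li2_term.
    unfold Cmod; simpl. replace (0 * (0 * 1) + 1 * (1 * 1)) with 1 by ring.
    rewrite sqrt_1; lra. }
  apply is_series_even in Hc.
  - rewrite <- (is_series_unique _ _ Hc). apply Series_ext; intros [|k]; [simpl; ring|].
    replace (2 * S k)%nat with (S (S (2 * k))) by lia. unfold Li2_term.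
    replace (S (S (2 * k))) with (2 * S k)%nat by lia.
    rewrite Hi, <- RtoC_pow, <- !RtoC_div, mult_INR.
    + rewrite !re_RtoC. replace (INR 2) with 2 by (simpl; ring). field. apply not_0_INR; lia.
    + pose proof (INR_S_pow_pos k 2). lra.
    + replace (2 * S k)%nat with (S (S (2 * k))) by lia.
      pose proof (INR_S_pow_pos (S (2 * k)) 2). lra.
  - intros k. unfold Li2_term. rewrite Cpow_S, Hi.
    unfold Cdiv. rewrite <- RtoC_inv by (pose proof (INR_S_pow_pos (2 * k) 2); lra).
    unfold Re; simpl; ring.
Qed.

Lemma Im_bern_sum_real (x : R) : Im (bern_sum (RtoC x)) = 0.
Proof.
  apply Series_0. intros n. rewrite <- RtoC_pow, <- RtoC_mult. reflexivity.
Qed.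

Lemma Im_dilog_rhs_real (x : R) : x < 0 -> Im (dilog_rhs (RtoC x)) = 0.
Proof.
  intros Hx. unfold dilog_rhs. rewrite Cexp_RtoC, <- RtoC_opp, Clog_RtoC by lra.
  assert (HL : Im (Li2_series (RtoC (exp x))) = 0).
  { apply Series_0. intros [|k]; [reflexivity|]. unfold Li2_term.
    rewrite <- RtoC_pow, <- RtoC_div by (pose proof (INR_S_pow_pos k 2); lra).
    reflexivity. }
  destruct (Li2_series _) as [m1 m2]. unfold Im in *; simpl in *. rewrite HL. ring.
Qed.

(* The duplication [Re (Li2 i) = Li2 (-1) / 4] compares the constant at [i pi] and at
   [i pi / 2], so the value of [zeta 2] is not needed. *)
Lemma bern_sum_eq_dilog_rhs (w : C) :
  Re w <= 0 -> w <> RtoC 0 -> Cmod w <= 2 * PI -> bern_sum w = dilog_rhs w.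
Proof.
  intros H1 H2 H3. pose proof PI_RGT_0 as Hpi.
  pose proof (bern_sum_minus_dilog_rhs_closed w H1 H2 H3) as Hw.
  set (c := (bern_sum (RtoC (-1)) - dilog_rhs (RtoC (-1)))%C) in *.
  assert (Him : Im c = 0).
  { unfold c. change (Im (bern_sum (RtoC (-1))) - Im (dilog_rhs (RtoC (-1))) = 0).
    rewrite Im_bern_sum_real, Im_dilog_rhs_real by lra. ring. }
  assert (Hy : forall y, 0 < y <= 2 * PI -> Re c =
    - (PI ^ 2 / 3 + y ^ 2 / 2 - PI * y - 2 * Re (Li2_series (cos y, sin y)))).
  { intros y Hy. rewrite <- Re_dilog_rhs_imaginary by lra.
    unfold c. rewrite <- (bern_sum_minus_dilog_rhs_closed (0, y)).
    - change (Re (bern_sum (0, y)) - Re (dilog_rhs (0, y)) = - Re (dilog_rhs (0, y))).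
      rewrite Re_bern_sum_imaginary. ring.
    - unfold Re; simpl; lra.
    - intros E. injection E. lra.
    - unfold Cmod; simpl. replace (0 * (0 * 1) + y * (y * 1)) with (y ^ 2) by ring.
      rewrite sqrt_pow2; lra. }
  (* With [A = Re (Li2 (-1))], the point [i PI] gives [Re c = PI ^ 2 / 6 + 2 A] and [i PI / 2] gives
     [Re c = PI ^ 2 / 24 + A / 2], a quarter of it; hence [Re c = 0]. *)
  pose proof (Hy PI ltac:(lra)) as Ha. pose proof (Hy (PI / 2) ltac:(lra)) as Hb.
  rewrite cos_PI, sin_PI in Ha. rewrite cos_PI2, sin_PI2, Re_Li2_series_i in Hb.
  change (-1, 0) with (RtoC (-1)) in Ha.
  assert (Hre : Re c = 0) by lra.
  assert (Hc : c = RtoC 0).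
  { clear - Hre Him. clearbody c. destruct c as [c1 c2].
    unfold RtoC, Re, Im in *; simpl in *; congruence. }
  rewrite Hc in Hw.
  transitivity (bern_sum w - dilog_rhs w + dilog_rhs w)%C; [ring|]. rewrite Hw; ring.
Qed.

(** * Branches of the logarithm *)

(** Brings the modulus to the denominator that occurs in [cos (atan (y / x))] and
    [sin (atan (y / x))]. *)
Lemma sqrt_sum_sq (x y : R) : x <> 0 ->
  sqrt (x ^ 2 + y ^ 2) = Rabs x * sqrt (1 + (y / x)²).
Proof.
  intros Hx. rewrite <- sqrt_Rsqr_abs, <- sqrt_mult.
  - f_equal. unfold Rsqr. field; assumption.
  - apply Rle_0_sqr.
  - pose proof (Rle_0_sqr (y / x)). lra.
Qed.

Lemma Cexp_Clog (z : C) : z <> RtoC 0 -> Cexp (Clog z) = z.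
Proof.
  intros Hz. assert (Hm : 0 < Cmod z) by now apply Cmod_gt_0.
  unfold Cexp, Clog, Re, Im; cbn [fst snd]. rewrite exp_ln by assumption.
  destruct z as [x y].
  assert (Hs : 0 < sqrt (1 + (y / x)²)).
  { apply sqrt_lt_R0. pose proof (Rle_0_sqr (y / x)). lra. }
  assert (Hc : x <> 0 -> Cmod (x, y) = Rabs x * sqrt (1 + (y / x)²))
    by (intros Hx; unfold Cmod; cbn [fst snd]; now apply sqrt_sum_sq).
  unfold Carg; cbn [fst snd].
  destruct (Rlt_dec 0 x) as [H|H]; [|destruct (Rlt_dec x 0) as [H1|H1]].
  - rewrite Hc, Rabs_pos_eq, cos_atan, sin_atan by lra.
    f_equal; field; repeat split; lra.
  - rewrite Hc, Rabs_left by lra.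
    destruct (Rle_dec 0 y).
    + rewrite neg_cos, neg_sin, cos_atan, sin_atan. f_equal; field; repeat split; lra.
    + rewrite cos_minus, sin_minus, cos_PI, sin_PI, cos_atan, sin_atan.
      f_equal; field; repeat split; lra.
  - assert (x = 0) by lra. subst x.
    assert (Hy : Cmod (0, y) = Rabs y).
    { unfold Cmod; cbn [fst snd]. replace (0 ^ 2 + y ^ 2) with (y²) by (unfold Rsqr; ring).
      apply sqrt_Rsqr_abs. }
    rewrite Hy in *.
    destruct (Rlt_dec 0 y); [|destruct (Rlt_dec y 0)].
    + rewrite cos_PI2, sin_PI2, Rabs_pos_eq by lra. f_equal; ring.
    + rewrite cos_neg, sin_neg, cos_PI2, sin_PI2, Rabs_left by lra. f_equal; ring.
    + replace y with 0 in Hm by lra. rewrite Rabs_R0 in Hm. lra.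
Qed.

(** The only half-turn that keeps an argument [t] inside [(- PI, PI]]. *)
Definition branch_shift (t : R) : R := if Rle_dec t 0 then PI else - PI.

Lemma Carg_right_sign (x y : R) : 0 < x -> (Carg (x, y) <= 0 <-> y <= 0).
Proof.
  intros Hx. rewrite Carg_pos by assumption. pose proof atan_0 as H0. split; intros H.
  - apply Rnot_lt_le; intros Hy.
    pose proof (atan_increasing 0 (y / x) (Rdiv_lt_0_compat _ _ Hy Hx)). lra.
  - rewrite <- H0. destruct H as [H| ->].
    + left. apply atan_increasing. apply Rlt_div_l; lra.
    + right. f_equal. field; lra.
Qed.

Lemma Carg_opp (z : C) : z <> RtoC 0 -> Carg (- z)%C = Carg z + branch_shift (Carg z).
Proof.
  intros Hz. destruct z as [x y]. pose proof PI_RGT_0 as Hpi.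
  change (- (x, y))%C with (- x, - y).
  assert (Hq : x <> 0 -> - y / - x = y / x) by (intros; field; assumption).
  unfold branch_shift.
  destruct (Rtotal_order x 0) as [H|[H|H]].
  - rewrite (Carg_pos (- x)), Hq by lra. pose proof (atan_bound (y / x)) as Ha.
    unfold Carg; cbn [fst snd].
    destruct (Rlt_dec 0 x); [lra|]. destruct (Rlt_dec x 0); [|lra].
    destruct (Rle_dec 0 y); match goal with |- context [Rle_dec ?t 0] =>
      destruct (Rle_dec t 0) end; lra.
  - subst x. unfold Carg; cbn [fst snd]. rewrite Ropp_0.
    destruct (Rlt_dec 0 0); [lra|].
    destruct (Rlt_dec 0 y), (Rlt_dec y 0), (Rlt_dec 0 (- y)), (Rlt_dec (- y) 0);
      try lra; try (match goal with |- context [Rle_dec ?t 0] =>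
      destruct (Rle_dec t 0) end; lra).
    exfalso. apply Hz. unfold RtoC. f_equal. lra.
  - pose proof (Carg_right_sign x y H) as Hsign. rewrite (Carg_pos x y) in * by assumption.
    unfold Carg; cbn [fst snd].
    destruct (Rlt_dec 0 (- x)); [lra|]. destruct (Rlt_dec (- x) 0); [|lra].
    rewrite Hq by lra.
    destruct (Rle_dec 0 (- y)), (Rle_dec (atan (y / x)) 0); lra || (exfalso; lra).
Qed.

Lemma Clog_opp (z : C) : z <> RtoC 0 ->
  Clog (- z)%C = (Clog z + (0, branch_shift (Carg z)))%C.
Proof.
  intros Hz. unfold Clog, Cplus; cbn [fst snd]. now rewrite Cmod_opp, Carg_opp, Rplus_0_r.
Qed.

(** [Clog z] lies in the right half-plane with imaginary part [Carg z], so its own argument has the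
    sign of [Carg z]. This is why both negated logarithms shift alike. *)
Lemma branch_shift_Clog (z : C) : 0 < Re (Clog z) ->
  branch_shift (Carg (Clog z)) = branch_shift (Carg z).
Proof.
  intros H. unfold branch_shift.
  pose proof (Carg_right_sign (Re (Clog z)) (Im (Clog z)) H) as Hs.
  change (Re (Clog z), Im (Clog z)) with (Clog z) in Hs.
  change (Im (Clog z)) with (Carg z) in Hs.
  destruct (Rle_dec (Carg (Clog z)) 0), (Rle_dec (Carg z) 0); tauto || reflexivity.
Qed.

Lemma Cexp_opp (w : C) : Cexp (- w)%C = (/ Cexp w)%C.
Proof.
  destruct w as [a b]. unfold Cexp, Cinv, Re, Im; cbn [fst snd Copp].
  rewrite cos_neg, sin_neg, exp_Ropp. pose proof (exp_pos a).
  replace ((exp a * cos b) ^ 2 + (exp a * sin b) ^ 2) with (exp a ^ 2 * ((sin b)² + (cos b)²))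
    by (unfold Rsqr; ring).
  rewrite sin2_cos2. f_equal; field; lra.
Qed.

(** * The series over even indices and the theorem *)

Definition bern_term (w : C) (k : nat) : C :=
  match k with
  | O => RtoC 0
  | S _ => Cdiv (Cmult (Cpow w (2 * k + 1)) (RtoC (Bernoulli (2 * k))))
             (RtoC (INR k * INR (fact (2 * k + 1))))
  end.

Lemma bern_term_eq (w : C) (k : nat) :
  (RtoC (bern_sum_coef (2 * k)) * Cpow w (S (2 * k)))%C = bern_term w k.
Proof.
  destruct k as [|k].
  - unfold bern_sum_coef. simpl (2 * 0)%nat. rewrite coth_coef_0.
    replace (2 * 0 / (INR 0 * INR 1)) with 0 by (unfold Rdiv; ring).
    unfold bern_term; ring.
  - unfold bern_term. rewrite Nat.add_1_r.
    assert (H1 : INR (S k) <> 0) by (apply not_0_INR; lia).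
    assert (H2 : INR (2 * S k) <> 0) by (apply not_0_INR; lia).
    assert (H3 : INR (S (2 * S k)) <> 0) by (apply not_0_INR; lia).
    replace (bern_sum_coef (2 * S k)) with
      (Bernoulli (2 * S k) * / (INR (S k) * INR (fact (S (2 * S k))))).
    + rewrite RtoC_mult, RtoC_inv; [unfold Cdiv; ring|].
      apply Rmult_integral_contrapositive_currified; [assumption|apply INR_fact_neq_0].
    + rewrite fact_simpl, mult_INR.
      unfold bern_sum_coef, coth_coef, bern_coef.
      replace (delta 1 (2 * S k)) with 0
        by (unfold delta; destruct (Nat.eqb_spec (2 * S k) 1); [lia|reflexivity]).
      replace (delta 0 (2 * S k)) with 0
        by (unfold delta; destruct (Nat.eqb_spec (2 * S k) 0); [lia|reflexivity]).
      pose proof (INR_fact_neq_0 (2 * S k)) as Hf.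
      assert (E : INR (2 * S k) = 2 * INR (S k)) by (rewrite mult_INR; simpl (INR 2); ring).
      set (F := INR (fact (2 * S k))) in *. set (T := INR (S (2 * S k))) in *.
      rewrite E. field. repeat split; assumption.
Qed.

Lemma is_Cseries_bern_term (w : C) : Cmod w <= 2 * PI ->
  is_Cseries (bern_term w) (bern_sum w).
Proof.
  intros Hw. apply is_Cseries_ext with (1 := bern_term_eq w).
  apply (is_Cseries_even (fun n => RtoC (bern_sum_coef n) * Cpow w (S n))%C);
    [|now apply is_Cseries_bern_sum].
  intros k. unfold bern_sum_coef. rewrite coth_coef_odd.
  - replace (2 * 0 / (INR (S (2 * k)) * INR (S (S (2 * k))))) with 0 by (unfold Rdiv; ring).
    ring.
  - rewrite Nat.odd_succ. apply Nat.even_spec. now exists k.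
Qed.

Lemma bern_term_opp (w : C) (k : nat) : bern_term (- w) k = (RtoC (-1) * bern_term w k)%C.
Proof.
  destruct k as [|k]; unfold bern_term; [ring|].
  replace (Cpow (- w) (2 * S k + 1)) with (- Cpow w (2 * S k + 1))%C.
  - unfold Cdiv; ring.
  - rewrite !Cpow_add_r, !Cpow_mult_r, !Cpow_1_r.
    replace (Cpow (- w) 2) with (Cpow w 2) by ring. ring.
Qed.

Theorem theorem8 (z : Complex.C) (hz0 : z <> RtoC 0)
  (hz : 0 < Cmod (Clog z) <= 2 * PI) :
  is_series
    (fun k : nat => match k with
      | O => RtoC 0
      | S _ => Cdiv (Cmult (Cpow (Clog z) (2 * k + 1)) (RtoC (Bernoulli (2 * k))))
                    (RtoC (INR k * INR (Factorial.fact (2 * k + 1))))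
      end)
    (Cminus
      (Cplus
        (Cminus (RtoC (PI ^ 2 / 3)) (Cmult (RtoC (1 / 2)) (Cpow (Clog z) 2)))
        (Cmult (Cmult (RtoC 2) (Clog z)) (Cminus (RtoC 1) (Clog (Copp (Clog z))))))
      (Cmult (RtoC 2) (Li2 z))).
Proof.
  apply is_Cseries_is_series. change (is_Cseries (bern_term (Clog z))
    (RtoC (PI ^ 2 / 3) - RtoC (1 / 2) * Cpow (Clog z) 2
     + RtoC 2 * Clog z * (RtoC 1 - Clog (- Clog z)) - RtoC 2 * Li2 z)%C).
  pose proof (Cexp_Clog z hz0) as Hexp.
  assert (Hw0 : Clog z <> RtoC 0) by (apply Cmod_gt_0; lra).
  assert (Hm : 0 < Cmod z) by now apply Cmod_gt_0.
  unfold Li2. destruct (Rle_dec (Cmod z) 1) as [H1|H1].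
  - rewrite <- Hexp at 5. fold (dilog_rhs (Clog z)).
    rewrite <- bern_sum_eq_dilog_rhs; [now apply is_Cseries_bern_term| |assumption|lra].
    change (ln (Cmod z) <= 0). rewrite <- ln_1. apply ln_le; lra.
  - assert (Hre : 0 < Re (Clog z)).
    { change (0 < ln (Cmod z)). rewrite <- ln_1. apply ln_increasing; lra. }
    rewrite (Clog_opp z hz0), (Clog_opp (Clog z) Hw0), branch_shift_Clog by assumption.
    rewrite <- Hexp at 6. rewrite <- Cexp_opp.
    (* Both values of the shift have the same square [- PI ^ 2]. Writing [PI ^ 2] as [- t ^ 2] turns
       the inversion into an algebraic identity in which the cross terms [2 w t] cancel. *)
    assert (Ht : ((0, branch_shift (Carg z)) * (0, branch_shift (Carg z)) = RtoC (- (PI * PI)))%C).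
    { unfold branch_shift, Cmult, RtoC; cbn [fst snd].
      destruct (Rle_dec (Carg z) 0); f_equal; ring. }
    set (w := Clog z) in *. set (t := (0, branch_shift (Carg z))) in *.
    assert (Hopp : is_Cseries (bern_term (- w)) (dilog_rhs (- w))).
    { rewrite <- bern_sum_eq_dilog_rhs.
      - apply is_Cseries_bern_term. rewrite Cmod_opp; lra.
      - change (- Re w <= 0); lra.
      - intros E. apply Hw0. replace w with (- - w)%C by ring. rewrite E; ring.
      - rewrite Cmod_opp; lra. }
    apply (is_Cseries_mult_l (RtoC (-1))) in Hopp.
    match goal with |- is_Cseries _ ?v => replace v with (RtoC (-1) * dilog_rhs (- w))%C end.
    + revert Hopp. apply is_Cseries_ext; intros k. rewrite bern_term_opp. ring.
    + unfold dilog_rhs. replace (- - w)%C with w by ring.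
      set (L := Li2_series _).
      assert (E3 : RtoC (PI ^ 2 / 3) = (- (t * t) / RtoC 3)%C).
      { rewrite Ht, <- RtoC_opp, <- RtoC_div by lra. f_equal; field. }
      assert (E6 : RtoC (PI ^ 2 / 6) = (- (t * t) / RtoC 6)%C).
      { rewrite Ht, <- RtoC_opp, <- RtoC_div by lra. f_equal; field. }
      rewrite E3, E6, (RtoC_div 1 2) by lra. field.
Qed.
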